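(* Let $\Delta_S$ be the triangulation of $[0,4]\times[0,2]$ with eight triangles described in the context. For every integer $r\ge 0$ and every integer $d\ge 2r+1$, $$\dim_{\mathbb R} C^r_d(\Delta_S)=L(\Delta_S,r,d),$$ where $$L(\Delta_S,r,d)=\binom{d+2}{2}+9\binom{d-r+1}{2}-2\left(\binom{d+2}{2}-\binom{r+2}{2}\right)+\sigma,\qquad \sigma=2\sum_{j\ge 1}\max\{r+1-2j,\,0\}.$$
   Context: $\Delta_S$ is the planar simplicial complex with boundary vertices $(0,0),(0,2),(2,2),(4,2),(4,0),(2,0)$, interior vertices $v_1=(1,1)$ and $v_2=(3,1)$, and the eight triangles (given by their vertices) $T_1=\{(0,2),(2,2),(1,1)\}$, $T_2=\{(2,2),(1,1),(3,1)\}$, $T_3=\{(2,2),(4,2),(3,1)\}$, $T_4=\{(4,2),(4,0),(3,1)\}$, $T_5=\{(4,0),(2,0),(3,1)\}$, $T_6=\{(2,0),(1,1),(3,1)\}$, $T_7=\{(2,0),(0,0),(1,1)\}$, $T_8=\{(0,0),(0,2),(1,1)\}$. For a finite planar simplicial complex $\Delta$ whose geometric realization $|\Delta|$ is a topological disk in $\mathbb R^2$, $C^r_d(\Delta)$ is the real vector space of functions $F:|\Delta|\to\mathbb R$ of class $C^r$ whose restriction to each triangle of $\Delta$ is a polynomial of degree at most $d$. Equivalently, writing $F_i$ for the polynomial on triangle $T_i$, whenever $T_i$ and $T_j$ share an interior edge lying on the line $\ell_{ij}=0$, the difference $F_i-F_j$ is divisible by $\ell_{ij}^{\,r+1}$.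 In general the Alfeld–Schumaker formula is $$L(\Delta,r,d)=\binom{d+2}{2}+\binom{d-r+1}{2}f_1^0-\left(\binom{d+2}{2}-\binom{r+2}{2}\right)f_0^0+\sum_{i}\sigma_i,$$ where $f_1^0$ is the number of interior edges, $f_0^0$ is the number of interior vertices, the sum is over the interior vertices $v_i$, $\sigma_i=\sum_{j\ge1}\max\{r+1+j(1-n(v_i)),0\}$, and $n(v_i)$ is the number of distinct slopes of edges at $v_i$. For $\Delta_S$ one has $f_1^0=9$, $f_0^0=2$, $n(v_1)=n(v_2)=3$, giving the expression in the claim. *)

(* Defs.v *)
From HB Require Import structures.
From mathcomp Require Import all_boot all_order all_algebra.
From mathcomp Require Import -(notations) mpoly.
From mathcomp Require Import all_classical all_reals all_analysis.

Set Implicit Arguments.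
Unset Strict Implicit.
Unset Printing Implicit Defensive.

Import Order.TTheory GRing.Theory Num.Theory numFieldNormedType.Exports.

Local Open Scope classical_set_scope.
Local Open Scope ring_scope.

Definition triangle (R : realType) : Type :=
  ((R * R) * (R * R) * (R * R))%type.

(* The closed triangle: the convex hull of the three vertices. *)
Definition tri_set (R : realType) (T : triangle R) : set (R * R) :=
  let: (A, B, C) := T in
  [set p | exists a b c : R,
    [/\ 0 <= a, 0 <= b, 0 <= c, a + b + c = 1 &
        p = (a * A.1 + b * B.1 + c * C.1, a * A.2 + b * B.2 + c * C.2)]].

Definition realization (R : realType) (Delta : seq (triangle R)) :
    set (R * R) :=
  [set p | exists2 T, T \in Delta & tri_set T p].

(* F is of class C^r on the closed region D: F is continuous on D, and the
   partial derivatives of F of order up to r exist in the interior of D and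
   extend to continuous functions on D.  Only the values of F on D matter. *)
Fixpoint class_C (R : realType) (D : set (R * R)) (r : nat)
    (F : R * R -> R) : Prop :=
  {within D, continuous F} /\
  match r with
  | 0 => True
  | r'.+1 => exists Fx Fy : R * R -> R,
      [/\ class_C D r' Fx, class_C D r' Fy &
          forall p : R * R, interior D p ->
            is_derive p ((1, 0) : R * R) F (Fx p) /\
            is_derive p ((0, 1) : R * R) F (Fy p)]
  end.

(* [mmeasure mdeg q] is the total degree of q plus one (and 0 for q = 0). *)
Definition poly_on (R : realType) (d : nat) (A : set (R * R))
    (F : R * R -> R) : Prop :=
  exists2 q : mpoly 2 R, (mmeasure mdeg q <= d.+1)%N &
    forall p, A p -> F p = meval (fun i => if i == ord0 then p.1 else p.2) q.

(* C^r_d(Delta), inside the real vector space of all functions on |Delta|;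
   F is any function on the plane that restricts to f. *)
Definition spline (R : realType) (Delta : seq (triangle R)) (r d : nat) :
    set (set_type (realization Delta) -> R^o) :=
  [set f | exists F : R * R -> R,
    [/\ forall p, f p = F (set_val p),
        class_C (realization Delta) r F &
        forall T, T \in Delta -> poly_on d (tri_set T) F]].

Arguments spline {R} Delta r d _.

(* S is a linear subspace of dimension n: it is the set of linear
   combinations of n linearly independent vectors. *)
Definition has_dim (R : realType) (V : lmodType R) (S : set V) (n : nat) :
    Prop :=
  exists b : 'I_n -> V,
    (forall c : 'I_n -> R, \sum_i c i *: b i = 0 -> forall i, c i = 0) /\
    (forall v, S v <-> exists c : 'I_n -> R, v = \sum_i c i *: b i).

Definition Delta_S (R : realType) : seq (triangle R) :=
  let v1 : R * R := (1, 1) in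
  let v2 : R * R := (3, 1) in
  [:: ((0, 2), (2, 2), v1);
      ((2, 2), v1, v2);
      ((2, 2), (4, 2), v2);
      ((4, 2), (4, 0), v2);
      ((4, 0), (2, 0), v2);
      ((2, 0), v1, v2);
      ((2, 0), (0, 0), v1);
      ((0, 0), (0, 2), v1)].

(* The terms with j > r vanish, so the sum over all j >= 1 stops at j = r. *)
Definition sigma (r : nat) : int :=
  2 * \sum_(1 <= j < r.+1) Num.max (r%:Z + 1 - 2 * j%:Z) 0.

(* Meant for d >= r, so that the truncated subtraction in [(d - r).+1] is the
   integer one. *)
Definition L (r d : nat) : int :=
  'C(d.+2, 2)%:Z + 9 * 'C((d - r).+1, 2)%:Z
  - 2 * ('C(d.+2, 2)%:Z - 'C(r.+2, 2)%:Z) + sigma r.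

(* Main.v *)
From HB Require Import structures.
Require Import Defs.
From mathcomp Require Import all_boot all_order all_algebra.
From mathcomp Require Import -(notations) mpoly.
From mathcomp Require Import all_classical all_reals all_analysis.
From mathcomp Require Import zify ring lra.

(* Put s = r + 1, and use the coordinates a = x + y - 2 and b = x - y, in which
   the interior vertices are (0, 0) and (2, 2) and the interior edges lie on
   the lines a = 0, b = 0, a = 2, b = 2 and h = b - a = 0. Following the edges
   around the two interior vertices, a spline amounts to a free polynomial of
   degree at most d (its restriction to T_6), four free polynomials of degree
   at most d - s, two free polynomials of degree at most d - 2 s (the syzygies
   of a^s, b^s and of (a - 2)^s, (b - 2)^s), and an element g of the space G of
   polynomials of degree at most d - s such that h^s g lies in both (a^s, b^s)
   and ((a - 2)^s, (b - 2)^s).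

   Counting conditions degree by degree bounds dim G from below. For the upper
   bound, let D_j be the space defined as G with h^j in place of h^s and degree
   at most d - j. Multiplication by h embeds D_(j+1) in D_j as the kernel of
   the restriction to h = 0. By an injectivity statement of strong Lefschetz
   type, this restriction maps D_j into the multiples of X^t (X - 2)^t, where
   t is the integer part of s - j / 2; since d >= 2 s - 1, the number of such
   polynomials that the degree allows is d - j + 1 - 2 t >= 0. Since h^(2 s)
   lies in both ideals, D_(2 s) consists of all polynomials of degree at most
   d - 2 s, and summing over j from s to 2 s - 1 gives the lower bound again. *)

Set Implicit Arguments.
Unset Strict Implicit.
Unset Printing Implicit Defensive.

Import Order.TTheory GRing.Theory Num.Theory numFieldNormedType.Exports.

Local Open Scope ring_scope.

(** * Polynomials in a and b: degree bounds, translations, homogeneous components, ideals of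
    powers *)

Section BivariatePolynomials.
Variable R : numFieldType.
Implicit Types (f g w : {poly {poly R}}) (c : R) (n k s : nat).

(* The outer variable is [b] and the inner one is [a]: [f`_i`_j] is the
   coefficient of [a ^+ j * b ^+ i]. *)
Definition deg_lt n f := forall i j, (n <= i + j)%N -> f`_i`_j = 0.

Lemma size_deg_lt n f i : deg_lt n f -> (size (f`_i)%R <= n - i)%N.
Proof. by move=> df; apply/leq_sizeP => j le_j; apply: df; lia. Qed.

Lemma deg_lt0 f : deg_lt 0 f -> f = 0.
Proof. by move=> df; do 2 apply/polyP => ?; rewrite !coef0 df. Qed.

Lemma deg_lt_mono n k f : (n <= k)%N -> deg_lt n f -> deg_lt k f.
Proof. by move=> le_nk df i j le_k; apply: df; lia. Qed.

Lemma deg_lt_zero n : deg_lt n 0.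
Proof. by move=> i j _; rewrite !coef0. Qed.

Lemma deg_ltD n f g : deg_lt n f -> deg_lt n g -> deg_lt n (f + g).
Proof. by move=> df dg i j le_n; rewrite !coefD df ?dg ?addr0. Qed.

Lemma deg_ltN n f : deg_lt n f -> deg_lt n (- f).
Proof. by move=> df i j le_n; rewrite !coefN df ?oppr0. Qed.

Lemma deg_ltB n f g : deg_lt n f -> deg_lt n g -> deg_lt n (f - g).
Proof. by move=> df dg; apply: deg_ltD => //; apply: deg_ltN. Qed.

Lemma deg_lt_sum n (I : Type) (r : seq I) (P : pred I)
    (F : I -> {poly {poly R}}) :
  (forall i, P i -> deg_lt n (F i)) -> deg_lt n (\sum_(i <- r | P i) F i).
Proof.
by move=> dF; elim/big_ind: _ => //; [apply: deg_lt_zero|apply: deg_ltD].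
Qed.

Lemma deg_ltM n k f g : deg_lt n.+1 f -> deg_lt k g -> deg_lt (n + k) (f * g).
Proof.
move=> df dg i j le_n; rewrite coefM coef_sum big1 // => u _.
rewrite coefM big1 // => v _; have := ltn_ord u; have := ltn_ord v.
case: (leqP n.+1 (u + v)) => [/df->|*]; first by rewrite mul0r.
by rewrite [X in _ * X]dg ?mulr0 //; lia.
Qed.

Lemma deg_ltC c : deg_lt 1 c%:P%:P.
Proof.
by move=> [|i] [|j]; rewrite coefC //= ?coefC ?coef0.
Qed.

Lemma deg_lt1 : deg_lt 1 1. Proof. exact: (deg_ltC 1). Qed.

Lemma deg_ltX : deg_lt 2 'X.
Proof. by move=> [|[|i]] [|j]; rewrite coefX ?coef0 ?coef1. Qed.

Lemma deg_ltXi : deg_lt 2 'X%:P.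
Proof. by move=> [|i] [|[|j]]; rewrite coefC ?coefX ?coef0. Qed.

Lemma deg_ltCM n c f : deg_lt n f -> deg_lt n (c%:P%:P * f).
Proof. exact: (deg_ltM (deg_ltC c)). Qed.

Lemma deg_lt_exp s f : deg_lt 2 f -> deg_lt s.+1 (f ^+ s).
Proof.
move=> df; elim: s => [|s IHs]; first exact: deg_lt1.
rewrite exprS; exact: (deg_ltM df IHs).
Qed.

(** The interface for edge equations. The last clause excludes constants and gives division with
    control of the degree, by which quotients of jumps get their degree bounds. *)
Definition linear_form l :=
  [/\ l != 0, deg_lt 2 l & forall n w, deg_lt n (l * w) -> deg_lt n.-1 w].

(** The form is monic in b, so the coefficients of w satisfy w_i = (l w)_(i+1) + L w_(i+1), and the
    bound descends from the top coefficient of w. *)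
Lemma linear_formX (L : {poly R}) : (size L <= 2)%N -> linear_form ('X - L%:P).
Proof.
move=> sL; split; first by rewrite polyXsubC_eq0.
  apply: deg_ltB; first exact: deg_ltX.
  move=> [|i] j le_j; rewrite coefC ?coef0 //=.
  by apply: nth_default; apply: leq_trans sL _.
move=> n w dw.
have IH m i j : (size w <= i + m)%N -> (n.-1 <= i + j)%N -> w`_i`_j = 0.
  elim: m i j => [|m IHm] i j.
    by rewrite addn0 => sw _; rewrite (_ : w`_i = 0) ?coef0 //;
      apply: nth_default.
  rewrite addnS -addSn => /IHm {}IHm le_n.
  have -> : w`_i = (('X - L%:P) * w)`_i.+1 + L * w`_i.+1.
    by rewrite mulrBl coefB coefXM coefCM /= subrK.
  rewrite coefD dw ?add0r; last by lia.
  rewrite coefM big1 // => u _; case: (leqP 2 u) => u2.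
    by rewrite [L`_u]nth_default ?mul0r //; apply: leq_trans sL _.
  by rewrite IHm ?mulr0 //; have := ltn_ord u; lia.
by move=> i j; apply: (IH (size w)); rewrite leq_addl.
Qed.

Lemma linear_formXi c : linear_form ('X - c%:P)%:P.
Proof.
split; first by rewrite polyC_eq0 polyXsubC_eq0.
  rewrite polyCB; apply: deg_ltB; first exact: deg_ltXi.
  exact: deg_lt_mono (deg_ltC _).
move=> n w dw i.
have IH m j : (size (w`_i)%R <= j + m)%N -> (n.-1 <= i + j)%N -> w`_i`_j = 0.
  elim: m j => [|m IHm] j; first by rewrite addn0 => sw _; apply: nth_default.
  rewrite addnS -addSn => /IHm {}IHm le_n.
  have := dw i j.+1; rewrite coefCM mulrBl coefB coefXM coefCM /= IHm;
    last by lia.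
  by rewrite mulr0 subr0; apply; lia.
by move=> j; apply: (IH (size (w`_i)%R)); rewrite leq_addl.
Qed.

Lemma deg_lt_divl l n s w :
  linear_form l -> deg_lt n (l ^+ s * w) -> deg_lt (n - s) w.
Proof.
move=> [_ _ dl]; elim: s n => [|s IHs] n; first by rewrite mul1r subn0.
rewrite exprS -mulrA => /dl /IHs; apply: deg_lt_mono; lia.
Qed.

Lemma deg_lt_mull l n s w : linear_form l ->
  deg_lt n w -> deg_lt (s + n) (l ^+ s * w).
Proof. by move=> [_ dl _] dw; apply: deg_ltM => //; apply: deg_lt_exp. Qed.

Lemma polyXiE f : f = \sum_(i < size f) \sum_(j < size (f`_i)%R)
  (f`_i`_j)%:P%:P * ('X%:P ^+ j * 'X ^+ i).
Proof.
rewrite -[LHS]coefK poly_def; apply: eq_bigr => i _.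
rewrite -[in LHS](coefK f`_i) poly_def -mul_polyC rmorph_sum /= mulr_suml.
apply: eq_bigr => j _; rewrite -mul_polyC polyCM mulrA; congr (_ * _ * _).
by rewrite -rmorphXn.
Qed.

Lemma poly2_rmorph_ext (S : nzRingType) (F G : {rmorphism {poly {poly R}} ->
  S}) :
  (forall c, F c%:P%:P = G c%:P%:P) -> F 'X%:P = G 'X%:P -> F 'X = G 'X ->
  F =1 G.
Proof.
move=> eC eXi eX f; rewrite [f]polyXiE !rmorph_sum /=; apply: eq_bigr => i _.
rewrite !rmorph_sum /=; apply: eq_bigr => j _.
by rewrite !rmorphM /= !rmorphXn /= eC eXi eX.
Qed.

Lemma deg_lt_rmorph (F : {rmorphism {poly {poly R}} -> {poly {poly R}}}) n f :
  (forall c, F c%:P%:P = c%:P%:P) -> deg_lt 2 (F 'X%:P) -> deg_lt 2 (F 'X) ->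
  deg_lt n f -> deg_lt n (F f).
Proof.
move=> eC dXi dX df; rewrite [f]polyXiE rmorph_sum; apply: deg_lt_sum => i _.
rewrite rmorph_sum; apply: deg_lt_sum => j _.
rewrite !rmorphM /= !rmorphXn /= eC; apply: deg_ltCM.
apply: (@deg_lt_mono (j + i.+1)); last first.
  by apply: deg_ltM; apply: deg_lt_exp.
have := ltn_ord j; rewrite ltnNge => nj; rewrite leqNgt; apply: contra nj => nj.
by apply: leq_trans (size_deg_lt i df) _; lia.
Qed.

(** Translation along the diagonal, substituting a + c and b + c. [tau 2] turns conditions at the
    interior vertex (2, 2) into conditions at the origin. *)
Definition tau c : {poly {poly R}} -> {poly {poly R}} :=
  comp_poly ('X + c%:P%:P) \o map_poly (comp_poly ('X + c%:P)).

HB.instance Definition _ c := GRing.RMorphism.on (tau c).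

Lemma tauC c (x : R) : tau c x%:P%:P = x%:P%:P.
Proof. by rewrite /tau /= map_polyC /= !comp_polyC. Qed.

Lemma tauX c : tau c 'X = 'X + c%:P%:P.
Proof. by rewrite /tau /= map_polyX /= comp_polyX. Qed.

Lemma tauXi c : tau c 'X%:P = 'X%:P + c%:P%:P.
Proof. by rewrite /tau /= map_polyC /= comp_polyX comp_polyC polyCD. Qed.

Lemma tauD c f g : tau c (f + g) = tau c f + tau c g.
Proof. exact: rmorphD. Qed.

Lemma tauN c f : tau c (- f) = - tau c f.
Proof. exact: rmorphN. Qed.

Lemma tauB c f g : tau c (f - g) = tau c f - tau c g.
Proof. exact: rmorphB. Qed.

Lemma tauM c f g : tau c (f * g) = tau c f * tau c g.
Proof. exact: rmorphM. Qed.

Lemma tauXn c f s : tau c (f ^+ s) = tau c f ^+ s.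
Proof. exact: rmorphXn. Qed.

Lemma tauK c : cancel (tau c) (tau (- c)).
Proof.
move=> f; have -> : tau (- c) (tau c f) = (tau (- c) \o tau c) f by [].
rewrite [RHS](_ : f = idfun f) //; move: f; apply: poly2_rmorph_ext.
- by move=> x; change (tau (- c) (tau c x%:P%:P) = x%:P%:P); rewrite !tauC.
- change (tau (- c) (tau c 'X%:P) = 'X%:P).
  by rewrite tauXi tauD tauXi tauC -addrA -!polyCD addNr addr0.
- change (tau (- c) (tau c 'X) = 'X).
  by rewrite tauX tauD tauX tauC -addrA -!polyCD addNr addr0.
Qed.

Lemma deg_lt_tau c n f : deg_lt n f -> deg_lt n (tau c f).
Proof.
apply: deg_lt_rmorph; first exact: tauC.
- change (deg_lt 2 (tau c 'X%:P)).
  rewrite tauXi; apply: deg_ltD; first exact: deg_ltXi.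
  exact: deg_lt_mono (deg_ltC _).
- change (deg_lt 2 (tau c 'X)).
  rewrite tauX; apply: deg_ltD; first exact: deg_ltX.
  exact: deg_lt_mono (deg_ltC _).
Qed.

Definition hline : {poly {poly R}} := 'X - 'X%:P.

Lemma linear_form_hline : linear_form hline.
Proof. by apply: linear_formX; rewrite size_polyX. Qed.

Lemma tau_hline c : tau c hline = hline.
Proof. by rewrite /hline tauB tauX tauXi; ring. Qed.

(** Restriction to the line h = 0, with a as the coordinate on it. *)
Definition diag f : {poly R} := f.['X].

Lemma diag_tau c f : diag (tau c f) = diag f \Po ('X + c%:P).
Proof.
have := @poly2_rmorph_ext _ (horner_eval 'X \o tau c)
  (comp_poly ('X + c%:P) \o horner_eval 'X).
move=> ext; apply: ext.
- move=> x; change ((tau c x%:P%:P).['X] = (x%:P%:P).['X] \Po ('X + c%:P)).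
  by rewrite tauC !hornerC comp_polyC.
- change ((tau c 'X%:P).['X] = ('X%:P).['X] \Po ('X + c%:P)).
  by rewrite tauXi hornerD !hornerC comp_polyX.
- change ((tau c 'X).['X] = ('X).['X] \Po ('X + c%:P)).
  by rewrite tauX hornerD hornerX hornerC comp_polyX.
Qed.

Lemma diag_eq0 f : diag f = 0 -> exists g, f = hline * g.
Proof.
by move/eqP/factor_theorem => [g ->]; exists g; rewrite mulrC.
Qed.

(* The component of total degree [k], dehomogenized by [b = 1]. *)
Definition gr k f : {poly R} := \poly_(u < k.+1) f`_(k - u)`_u.

Lemma coef_gr k f u : (gr k f)`_u = if (u <= k)%N then f`_(k - u)`_u else 0.
Proof. by rewrite coef_poly. Qed.

(** On the line b = a the component of degree k becomes a multiple of a^k, the factor being the sum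
    of its coefficients. *)
Lemma coef_diag f k : (diag f)`_k = (gr k f).[1].
Proof.
rewrite /diag /gr horner_poly horner_coef coef_sum.
under [RHS]eq_bigr do rewrite expr1n mulr1.
rewrite (eq_bigr (fun i : 'I__ => if (i <= k)%N then f`_i`_(k - i) else 0));
  last first.
  by move=> i _; rewrite coefMXn ltnNge; case: leqP.
rewrite -(big_mkord predT (fun i => if (i <= k)%N then f`_i`_(k - i) else 0)).
rewrite -(big_mkord predT (fun u => f`_(k - u)`_u)) [RHS]big_nat_rev /= add0n.
rewrite [RHS](eq_big_nat _ _ (F2 :=
  fun i => if (i <= k)%N then f`_i`_(k - i) else 0)); last first.
  by move=> i /andP[_]; rewrite ltnS => ik; rewrite subSS subKn // ik.
(* The two sums run over i < size f and over i <= k. The summand vanishes beyond either bound, so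
   the longer sum can be cut down to the shorter one. *)
have widen a b F : (forall i, (a <= i)%N -> F i = 0 :> R) -> (a <= b)%N ->
    \sum_(0 <= i < b) F i = \sum_(0 <= i < a) F i.
  move=> F0 ab;
    rewrite (big_cat_nat _ ab) //= [X in _ + X]big_nat [X in _ + X]big1 ?addr0 //.
  by move=> i /andP[/F0].
set F := fun i : nat => if (i <= k)%N then f`_i`_(k - i) else 0.
have Fs i : (size f <= i)%N -> F i = 0.
  by move=> si; rewrite /F (_ : f`_i = 0) ?coef0 ?if_same //;
    apply: nth_default.
have Fk i : (k.+1 <= i)%N -> F i = 0 by rewrite /F ltnNge; case: (i <= k)%N.
case: (leqP (size f) k.+1) => [le|/ltnW le].
  by rewrite [RHS](widen _ _ _ Fs).
by rewrite [LHS](widen _ _ _ Fk).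
Qed.

Lemma gr_hline0 f : gr 0 (hline * f) = 0.
Proof.
apply/polyP => u; rewrite coef_gr leqn0 coef0; case: eqP => // -> /=.
by rewrite mulrBl coefB coefXM coefCM sub0r coefN coefXM /= oppr0.
Qed.

(** Setting b = 1 turns h = b - a into 1 - X. *)
Lemma gr_hlineS k f : gr k.+1 (hline * f) = (1 - 'X) * gr k f.
Proof.
apply/polyP => u; rewrite [in RHS]mulrBl mul1r [in RHS]coefB coefXM !coef_gr.
rewrite mulrBl coefB coefXM coefCM coefB coefXM.
case: u => [|u] /=; first by rewrite !subn0 subr0.
rewrite subSS ltnS subn_eq0; case: (ltngtP k u) => [ku|ku|->].
- by rewrite subr0.
- by rewrite -[(k - u)%N]prednK ?subn_gt0 //= -subnS.
- by rewrite coef0.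
Qed.

Lemma gr_hlineX k j f : gr (j + k) (hline ^+ j * f) = (1 - 'X) ^+ j * gr k f.
Proof.
elim: j => [|j IHj]; first by rewrite !mul1r.
by rewrite !exprS -!mulrA addSn gr_hlineS IHj.
Qed.

Lemma gr_hlineX_lt k j f : (k < j)%N -> gr k (hline ^+ j * f) = 0.
Proof.
elim: j k => // j IHj [|k] lt_k; rewrite exprS -mulrA ?gr_hline0 //.
by rewrite gr_hlineS IHj ?mulr0.
Qed.

(* Membership in the ideal generated by the [s]-th powers of the variables. *)
Definition in_powers s f := forall i j, (i < s)%N -> (j < s)%N -> f`_i`_j = 0.

(** A canonical choice of cofactors: monomials divisible by a^s all go to [quoA], and [quoB] takes
    those of the remaining ones that b^s divides. Both are linear in f, which keeps the
    parametrization of splines linear. *)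
Definition quoA s f := map_poly (drop_poly s) f.
Definition quoB s f := drop_poly s (map_poly (take_poly s) f).

Lemma in_powersE s f : in_powers s f ->
  f = 'X%:P ^+ s * quoA s f + 'X ^+ s * quoB s f.
Proof.
move=> Jf; apply/polyP => i; apply/polyP => j.
have cA : ('X%:P ^+ s * quoA s f)`_i`_j = if (j < s)%N then 0 else f`_i`_j.
  rewrite -rmorphXn /= coefCM coefXnM /quoA coef_map_id0 ?drop_poly0r //.
  by case: ltnP => // sj; rewrite coef_drop_poly subnK.
have cB : ('X ^+ s * quoB s f)`_i`_j =
    if (i < s)%N then 0 else if (j < s)%N then f`_i`_j else 0.
  rewrite coefXnM; case: ltnP => si; first by rewrite coef0.
  by rewrite coef_drop_poly subnK // coef_map_id0 ?take_poly0r // coef_take_poly.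
rewrite !coefD cA cB; case: (ltnP j s) => sj; case: (ltnP i s) => si;
  by rewrite ?addr0 ?add0r // Jf.
Qed.

Lemma in_powers_comb s f g : in_powers s ('X%:P ^+ s * f + 'X ^+ s * g).
Proof.
move=> i j si sj; rewrite coefD -rmorphXn /= coefCM coefXnM si addr0.
by rewrite coefXnM sj.
Qed.

(** Multiples of b^s have no coefficient below b^s, so a^s f has none either, hence b^s divides f;
    cancelling b^s then gives g. *)
Lemma powers_syzygy s f g : 'X%:P ^+ s * f + 'X ^+ s * g = 0 ->
  exists w, f = 'X ^+ s * w /\ g = - ('X%:P ^+ s * w).
Proof.
move=> e0; exists (drop_poly s f).
have ef : f = 'X ^+ s * drop_poly s f.
  rewrite -{1}[f](poly_take_drop s) mulrC -[RHS]add0r; congr (_ + _).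
  apply/polyP => i; rewrite coef_take_poly coef0; case: ltnP => // si.
  apply/polyP => j; move/polyP/(_ i)/polyP/(_ (j + s)%N): e0.
  rewrite coefD -rmorphXn /= coefCM coefXnM si addr0 coefXnM ltnNge leq_addl /=.
  by rewrite addnK !coef0.
split=> //;
  have nX : ('X ^+ s : {poly {poly R}}) != 0 by rewrite monic_neq0 ?monicXn.
apply: (mulfI nX); apply/eqP; rewrite mulrN -addr_eq0 addrC mulrCA -ef.
exact/eqP.
Qed.

Lemma deg_lt_quoA s n f : deg_lt n f -> deg_lt (n - s) (quoA s f).
Proof.
move=> df i j le_n; rewrite coef_map_id0 ?drop_poly0r // coef_drop_poly df //.
lia.
Qed.

Lemma deg_lt_quoB s n f : deg_lt n f -> deg_lt (n - s) (quoB s f).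
Proof.
move=> df i j le_n.
rewrite coef_drop_poly coef_map_id0 ?take_poly0r // coef_take_poly df ?if_same //.
lia.
Qed.

Lemma derivn_expXsubC j p (q : {poly R}) c :
  exists q', (('X - c%:P) ^+ j * q)^`(p) = ('X - c%:P) ^+ (j - p) * q'.
Proof.
elim: p => [|p [q' IHp]]; first by exists q; rewrite subn0 derivn0.
rewrite derivnS IHp derivM deriv_exp derivXsubC mul1r subnS.
case: (j - p)%N => [|m] /=; first by exists q'^`(); rewrite mulr0n mul0r add0r.
exists (q' *+ m.+1 + ('X - c%:P) * q'^`()).
by rewrite exprS -mulr_natr; ring.
Qed.

(* Differentiating [p := (i + j).+1 - s] times moves the [i.+1] vanishing
   coefficients to the bottom, so ['X ^+ i.+1 * ('X - 1) ^+ (j - p)] divides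
   the [p]-th derivative, whose degree is too small. *)
Lemma lefschetz_injective i j s (q : {poly R}) :
  (size q <= i.+1)%N -> (2 * i + j + 2 <= 2 * s)%N ->
  (forall u, (i + j < u + s)%N -> (u < s)%N -> ((1 - 'X) ^+ j * q)`_u = 0) ->
  q = 0.
Proof.
move=> sq ijs c0; pose p := ((i + j).+1 - s)%N.
pose F := ('X - 1%:P) ^+ j * q.
have FE : (1 - 'X) ^+ j * q = (-1) ^+ j * F.
  by rewrite /F polyC1 mulrA -exprNn opprB.
have cF u : (i + j < u + s)%N -> (u < s)%N -> F`_u = 0.
  move=> u1 u2; have := c0 u u1 u2; rewrite FE.
  rewrite -signr_odd; case: (odd j); rewrite ?expr1 ?mulN1r ?mul1r ?coefN //.
  by move/eqP; rewrite oppr_eq0 => /eqP.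
have sF : (size F <= i + j + 1)%N.
  apply: leq_trans (size_polyMleq _ _) _; rewrite size_exp_XsubC addSn /=.
  by apply: leq_trans (leq_add (leqnn j) sq) _; lia.
have [q' Fq'] := derivn_expXsubC j p q 1.
have Fp0 : F^`(p) = 0.
  apply/eqP; apply: contraT => nF.
  have d1 : 'X ^+ i.+1 %| F^`(p).
    have -> : F^`(p) = drop_poly i.+1 F^`(p) * 'X^(i.+1).
      rewrite -{1}[F^`(p)](poly_take_drop i.+1) -[RHS]add0r; congr (_ + _).
      apply/polyP => u; rewrite coef_take_poly coef0; case: ltnP => // ui.
      rewrite coef_derivn cF ?mul0rn // /p; lia.
    exact: dvdp_mulIr.
  have d2 : ('X - 1%:P) ^+ (j - p) %| F^`(p) by rewrite Fq' dvdp_mulIl.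
  have : 'X ^+ i.+1 * ('X - 1%:P) ^+ (j - p) %| F^`(p).
    rewrite Gauss_dvdp ?d1 // coprimep_expl // coprimep_expr //.
    have := @coprimep_XsubC2 R 0 1; rewrite polyC0 !subr0; apply.
    exact: oner_neq0.
  move/(dvdp_leq nF).
  rewrite size_monicM ?monicXn // ?size_polyXn ?size_exp_XsubC; last first.
    by rewrite expf_neq0 // polyXsubC_eq0.
  have sF' : (size F^`(p) <= i + j + 1 - p)%N.
    apply: leq_trans (leq_sub2r p sF).
    elim: (p) => [|p' IH]; first by rewrite derivn0 subn0.
    rewrite derivnS; have [->|n0] := eqVneq F^`(p') 0;
      first by rewrite derivC size_poly0.
    have : ((size F^`(p')^`()).+1 <= size F - p')%N.
      exact: leq_trans (lt_size_deriv n0) IH.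
    by rewrite subnS; case: (size F - p')%N.
  by move=> /leq_trans /(_ sF'); rewrite /p; lia.
apply/eqP; apply: contraT => nq.
have nF : F != 0 by rewrite mulf_neq0 // expf_neq0 // polyXsubC_eq0.
(* In characteristic zero a vanishing p-th derivative forces degree below p, whereas F has degree at
   least j, and p <= j because i < s. *)
have : (size F <= p)%N.
  apply/leq_sizeP => u pu; have := congr1 (fun x : {poly R} => x`_(u - p)) Fp0.
  rewrite coef_derivn coef0 subnKC // => /eqP; rewrite mulrn_eq0.
  by rewrite -leqn0 leqNgt ffact_gt0 pu => /eqP.
rewrite /F size_monicM ?monic_exp ?monicXsubC // size_exp_XsubC addSn /=.
move: nq; rewrite -size_poly_gt0 => q0 /(leq_trans (leq_add (leqnn j) q0)).
by rewrite /p; lia.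
Qed.

End BivariatePolynomials.

(** * Linear algebra: subspaces cut out by predicates, and rank-nullity estimates *)

Section Dimension.
Variable K : fieldType.

Lemma linear_hom (V W : vectType K) (f : V -> W) :
  linear f -> exists F : 'Hom(V, W), F =1 f.
Proof.
move=> f_lin.
pose L := GRing.isLinear.Build K V W _ f f_lin.
pose F : {linear V -> W} := HB.pack f L.
by exists (linfun F) => v; rewrite lfunE.
Qed.

Lemma dimv_limg_le (V W : vectType K) (F : 'Hom(V, W)) U :
  (\dim (F @: U) <= \dim U)%N.
Proof. by rewrite -(limg_ker_dim F U) leq_addl. Qed.

(** Among the subspaces contained in S take one of maximal dimension; adjoining any vector of S
    cannot enlarge it. *)
Lemma vspace_of_pred (V : vectType K) (S : V -> Prop) :
  S 0 -> (forall (a : K) u v, S u -> S v -> S (a *: u + v)) ->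
  exists U : {vspace V}, forall v, v \in U <-> S v.
Proof.
move=> S0 SD.
pose P n := `[< exists U : {vspace V}, (\dim U = n) /\ forall v, v \in U ->
  S v >].
have P0 : exists n, P n.
  exists 0%N; apply/asboolP; exists 0%VS; split; first exact: dimv0.
  by move=> v; rewrite memv0 => /eqP->.
have Pb n : P n -> (n <= \dim {:V})%N.
  by move=> /asboolP[U [<- _]]; apply/dimvS/subvf.
case: (ex_maxnP P0 Pb) => n /asboolP[U [dU US]] maxn.
exists U => v; split; first exact: US.
move=> Sv; have : P (\dim (U + <[v]>)).
  apply/asboolP; exists (U + <[v]>)%VS;
    split=> // w /memv_addP[u uU [x /vlineP[k ->] ->]].
  by rewrite addrC; apply: SD => //; apply: US.
move/maxn; rewrite -dU => le_dim.
have /eqP-> : U == (U + <[v]>)%VS by rewrite eqEdim addvSl.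
by rewrite (subvP (addvSr _ _)) // memv_line.
Qed.

Lemma dimv_exact (V W : vectType K) (U U' : {vspace V}) (f : V -> W) :
  linear f -> (forall v, v \in U' <-> v \in U /\ f v = 0) ->
  (forall w, exists2 v, v \in U & f v = w) ->
  \dim U = (\dim U' + \dim {:W})%N.
Proof.
move=> /linear_hom[F FE] kerP surj.
have -> : U' = (U :&: lker F)%VS.
  apply/vspaceP => v; apply/idP/memv_capP.
    by move/kerP=> [vU fv]; rewrite vU memv_ker FE fv eqxx.
  by case=> vU; rewrite memv_ker FE => /eqP fv; apply/kerP.
have -> : fullv = (F @: U)%VS.
  apply/vspaceP => w; rewrite memvf; apply/esym/memv_imgP.
  by have [v vU <-] := surj w; exists v; rewrite ?FE.
by rewrite limg_ker_dim.
Qed.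

(** Rank-nullity as an estimate: the kernel of f on U is covered by the image of U' under h, and the
    image of f by that of g. *)
Lemma dimv_exact_le (V V' W X : vectType K) (U : {vspace V}) (U' : {vspace V'})
    (f : V -> W) (h : V' -> V) (g : X -> W) :
  linear f -> linear h -> linear g ->
  (forall v, v \in U -> f v = 0 -> exists2 v', v' \in U' & v = h v') ->
  (forall v, v \in U -> exists x, f v = g x) ->
  (\dim U <= \dim U' + \dim {:X})%N.
Proof.
move=> /linear_hom[F FE] /linear_hom[H HE] /linear_hom[G GE] kerP imP.
rewrite -(limg_ker_dim F U); apply: leq_add.
  apply: leq_trans (leq_trans (dimvS _) (dimv_limg_le H U')) _ => //.
  apply/subvP => v /memv_capP[vU]; rewrite memv_ker FE => /eqP fv.
  by have [v' v'U ->] := kerP v vU fv; rewrite -HE memv_img.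
apply: leq_trans (leq_trans (dimvS _) (dimv_limg_le G fullv)) _ => //.
apply/subvP => _ /memv_imgP[v vU ->]; rewrite FE.
by have [x ->] := imP v vU; rewrite -GE memv_img ?memvf.
Qed.

Lemma dimv_ker_le (V W : vectType K) (U U' : {vspace V}) (f : V -> W) :
  linear f -> (forall v, v \in U -> f v = 0 -> v \in U') ->
  (\dim U <= \dim U' + \dim {:W})%N.
Proof.
move=> f_lin kerP; apply: (dimv_exact_le (f := f) (h := id) (g := id)) => //.
- by move=> v vU fv; exists v => //; apply: kerP.
- by move=> v vU; exists (f v).
Qed.

End Dimension.

(** * Coefficient matrices as a finite-dimensional model of polynomials of bounded degree *)

Section BoundedPolynomials.
Variable R : numFieldType.
Variable N : nat.
Implicit Types (f g : {poly {poly R}}) (n s k j : nat).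

Definition of_mx (M : 'M[R]_N) : {poly {poly R}} :=
  \poly_(i < N) rVpoly (if insub i is Some i' then row i' M else 0).
Definition to_mx f : 'M[R]_N := \matrix_(i, j) f`_i`_j.

Lemma coef_of_mx M (i j : 'I_N) : (of_mx M)`_i`_j = M i j.
Proof. by rewrite coef_poly ltn_ord valK coef_rVpoly_ord mxE. Qed.

Lemma coef_of_mxE M i j : (of_mx M)`_i`_j =
  if insub i is Some i' then (if insub j is Some j' then M i' j' else 0) else 0.
Proof.
rewrite coef_poly; case: insubP => [i' -> iE|]; last first.
  by rewrite -leqNgt => Ni; rewrite ltnNge Ni coef0.
by rewrite coef_rVpoly; case: insub => // j'; rewrite mxE.
Qed.

Lemma of_mxK : cancel of_mx to_mx.
Proof. by move=> M; apply/matrixP => i j; rewrite mxE coef_of_mx. Qed.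

Lemma to_mxK f : deg_lt N f -> of_mx (to_mx f) = f.
Proof.
move=> df; apply/polyP => i; apply/polyP => j; rewrite coef_of_mxE.
case: insubP => [i' _ iE|]; last by rewrite -leqNgt => Ni; rewrite df //; lia.
case: insubP => [j' _ jE|]; last by rewrite -leqNgt => Nj; rewrite df //; lia.
by rewrite mxE iE jE.
Qed.

Lemma of_mx_linear (c : R) M M' : of_mx (c *: M + M') =
  c%:P%:P * of_mx M + of_mx M'.
Proof.
apply/polyP => i; apply/polyP => j.
rewrite coefD coefD !coefCM !coef_of_mxE.
case: insub => [i'|]; last by rewrite mulr0 addr0.
by case: insub => [j'|]; rewrite ?mxE // mulr0 addr0.
Qed.

Lemma to_mx_linear (c : R) f g : to_mx (c%:P%:P * f + g) =
  c *: to_mx f + to_mx g.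
Proof. by apply/matrixP => i j; rewrite !mxE !coefD !coefCM. Qed.

Lemma of_mx0 : of_mx 0 = 0.
Proof. by rewrite -(to_mxK (@deg_lt_zero R N)); congr of_mx;
  apply/matrixP => i j; rewrite !mxE !coef0. Qed.

(** Linearity over R. The scaling operation of [{poly {poly R}}] has its scalars in [{poly R}], so
    real scalars are written as constant polynomials. *)
Definition poly_linear (T : {poly {poly R}} -> {poly {poly R}}) :=
  forall (c : R) f g, T (c%:P%:P * f + g) = c%:P%:P * T f + T g.

Definition subspace (S : {poly {poly R}} -> Prop) :=
  S 0 /\ forall (c : R) f g, S f -> S g -> S (c%:P%:P * f + g).

Lemma subspace_vspace S : subspace S ->
  exists U : {vspace 'M[R]_N}, forall M, M \in U <-> S (of_mx M).
Proof.
case=> S0 SD; apply: vspace_of_pred; first by rewrite of_mx0.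
by move=> a M M' SM SM'; rewrite of_mx_linear; apply: SD.
Qed.

Lemma subspace_deg_lt n : subspace (@deg_lt R n).
Proof.
split=> [|c f g df dg]; first exact: deg_lt_zero.
by apply: deg_ltD => //; apply: deg_ltCM.
Qed.

Lemma dim_deg_lt n (U : {vspace 'M[R]_N}) : (n <= N)%N ->
  (forall M, M \in U <-> deg_lt n (of_mx M)) -> \dim U = 'C(n.+1, 2).
Proof.
elim: n U => [|n IHn] U nN UP.
  apply/eqP; rewrite bin_small // dimv_eq0; apply/eqP/vspaceP => M.
  rewrite memv0; apply/idP/eqP => [/UP /deg_lt0 M0|->]; last first.
    by apply/UP; rewrite of_mx0; apply: deg_lt_zero.
  by rewrite -(of_mxK M) M0 -of_mx0 of_mxK.
have [U' U'P] := subspace_vspace (subspace_deg_lt n).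
rewrite binS bin1 -(IHn U') //; last exact: ltnW.
(* Reading off the component of degree n, which has n + 1 free coefficients, leaves the polynomials
   of degree below n as kernel. *)
pose f (M : 'M[R]_N) : 'rV[R]_n.+1 := \row_i (of_mx M)`_(n - i)`_i.
rewrite (@dimv_exact _ _ _ U U' f).
- by rewrite dimvf /dim /= mul1n.
- by move=> c M M'; apply/rowP => i; rewrite !mxE of_mx_linear !coefD !coefCM.
- move=> M; split=> [/U'P dM|[/UP dM fM]].
    split; first by apply/UP; apply: deg_lt_mono dM.
    by apply/rowP => i; rewrite !mxE dM // subnK // -ltnS ltn_ord.
  apply/U'P => i j; rewrite leq_eqVlt => /orP[/eqP nij|]; last exact: dM.
  have jn : (j < n.+1)%N by lia.
  have := congr1 (fun r : 'rV_n.+1 => r 0 (Ordinal jn)) fM; rewrite !mxE /=.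
  by rewrite nij addnK.
- move=> w; pose M : 'M[R]_N :=
    \matrix_(i, j) if (i + j == n)%N then w 0 (inord j) else 0.
  exists M.
    apply/UP => i j nij; rewrite coef_of_mxE; case: insubP => // i' _ iE.
    by case: insubP => // j' _ jE; rewrite mxE iE jE gtn_eqF.
  apply/rowP => u; have un := ltn_ord u.
  have uN : (u < N)%N by apply: leq_trans nN; lia.
  have nuN : (n - u < N)%N by apply: leq_trans nN; rewrite ltnS leq_subr.
  rewrite mxE (coef_of_mx M (Ordinal nuN) (Ordinal uN)) mxE /= subnK //.
  by rewrite eqxx inord_val.
Qed.
End BoundedPolynomials.

(** * Upper bound for the colon spaces by restriction to h = 0 *)

Section ColonSpaces.
Variable R : numFieldType.
Variable N : nat.
Implicit Types (f g : {poly {poly R}}) (n s k j e l t : nat).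

Lemma in_powers_linear s (c : R) f g :
  in_powers s f -> in_powers s g -> in_powers s (c%:P%:P * f + g).
Proof.
by move=> Jf Jg i j si sj; rewrite !coefD !coefCM Jf // Jg // mulr0 addr0.
Qed.

Lemma tau_linear (a : R) : poly_linear (tau a).
Proof. by move=> c f g; rewrite tauD tauM tauC. Qed.

Lemma tau0 (a : R) : tau a 0 = 0. Proof. exact: rmorph0. Qed.

(* With [j = s] and [n] one more than the degree bound, these are the
   admissible jumps across the edge joining the two interior vertices, divided
   by [hline ^+ s]. *)
Definition colon s n j f :=
  [/\ deg_lt n f, in_powers s (hline R ^+ j * f)
    & in_powers s (hline R ^+ j * tau 2 f)].

Lemma mul_poly_linear (h : {poly {poly R}}) : poly_linear ( *%R h).
Proof. by move=> c f g; rewrite mulrDr mulrCA. Qed.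

Lemma subspace_colon s n j : subspace (colon s n j).
Proof.
split.
  split; first exact: deg_lt_zero.
    by move=> u v _ _; rewrite mulr0 !coef0.
  by move=> u v _ _; rewrite tau0 mulr0 !coef0.
move=> c f g [df Jf Kf] [dg Jg Kg]; split.
- by apply: deg_ltD => //; apply: deg_ltCM.
- by rewrite mul_poly_linear; apply: in_powers_linear.
- by rewrite tau_linear mul_poly_linear; apply: in_powers_linear.
Qed.

Lemma deg_lt_gr n f k : deg_lt n f -> (n <= k)%N -> gr k f = 0.
Proof.
move=> df nk; apply/polyP => u; rewrite coef_gr coef0; case: ifP => // uk.
by rewrite df // subnK.
Qed.

Lemma size_diag n f : deg_lt n f -> (size (diag f) <= n)%N.
Proof.
move=> df; apply/leq_sizeP => k nk.
by rewrite coef_diag (deg_lt_gr df nk) horner0.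
Qed.

(** For i < t the whole component of degree i of f vanishes: ideal membership in degree i + j kills
    the middle coefficients of (1 - X)^j [gr i f], and [lefschetz_injective] applies since 2 i + j +
    2 <= 2 s. *)
Lemma dvdp_diag s j t f : (2 * t + j <= 2 * s)%N ->
  in_powers s (hline R ^+ j * f) -> 'X^t %| diag f.
Proof.
move=> tjs Jf.
have -> : diag f = drop_poly t (diag f) * 'X^t.
  rewrite -{1}[diag f](poly_take_drop t) -[RHS]add0r; congr (_ + _).
  apply/polyP => i; rewrite coef_take_poly coef0; case: ltnP => // it.
  rewrite coef_diag (@lefschetz_injective _ i j s (gr i f)) ?horner0 //.
  - exact: size_poly.
  - by lia.
  - move=> u u1 u2; rewrite -gr_hlineX coef_gr; case: ifP => // uji.
    by rewrite Jf //; lia.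
exact: dvdp_mulIr.
Qed.

Definition double_zero t : {poly R} := 'X^t * ('X - 2%:P) ^+ t.

Lemma size_double_zero t : size (double_zero t) = (2 * t).+1.
Proof.
rewrite size_monicM ?monicXn ?expf_neq0 ?polyXsubC_eq0 // size_polyXn.
by rewrite size_exp_XsubC; lia.
Qed.

Lemma double_zero_neq0 t : double_zero t != 0.
Proof. by rewrite -size_poly_gt0 size_double_zero. Qed.

Lemma dvdp_double_zero s n j t f : (2 * t + j <= 2 * s)%N -> colon s n j f ->
  double_zero t %| diag f.
Proof.
move=> tjs [df Jf Kf]; rewrite /double_zero Gauss_dvdp; last first.
  rewrite coprimep_expl // coprimep_expr //.
  have := @coprimep_XsubC2 R 0 2; rewrite polyC0 !subr0; apply.
  by rewrite pnatr_eq0.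
rewrite (dvdp_diag tjs Jf); have := dvdp_diag tjs Kf; rewrite diag_tau.
case/dvdpP => q eq_q; apply/dvdpP; exists (q \Po ('X - 2%:P)).
have := congr1 (comp_poly ('X - 2%:P)) eq_q.
rewrite comp_polyM comp_Xn_poly -comp_polyA comp_polyD comp_polyX comp_polyC.
by rewrite subrK comp_polyXr.
Qed.

Lemma dim_colon_step s n j t (U U' : {vspace 'M[R]_N}) :
  (n <= N)%N -> (2 * t <= n)%N -> (2 * t + j <= 2 * s)%N ->
  (forall M, M \in U <-> colon s n j (of_mx M)) ->
  (forall M, M \in U' <-> colon s n.-1 j.+1 (of_mx M)) ->
  (\dim U <= \dim U' + (n - 2 * t))%N.
Proof.
move=> nN tn tjs UP U'P.
(* [f] restricts to the diagonal, [h] multiplies by [hline] and covers the kernel of [f], and [g]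
   parametrizes the multiples of [double_zero t] of size at most n. *)
pose f (M : 'M[R]_N) : 'rV[R]_N := poly_rV (diag (of_mx M)).
pose h (M : 'M[R]_N) : 'M[R]_N := to_mx N (hline R * of_mx M).
pose g (x : 'rV[R]_(n - 2 * t)) : 'rV[R]_N :=
  poly_rV (double_zero t * rVpoly x).
have -> : (n - 2 * t)%N =
  \dim {: 'rV[R]_(n - 2 * t)} by rewrite dimvf /dim /= mul1n.
apply: (@dimv_exact_le _ _ _ _ _ U U' f h g).
- move=> c u v; rewrite /f of_mx_linear /diag hornerD hornerM hornerC.
  by rewrite mul_polyC linearP.
- by move=> c u v; rewrite /h of_mx_linear mul_poly_linear to_mx_linear.
- by move=> c u v; rewrite /g linearP /= mulrDr -scalerAr linearP.
- move=> M /UP [dM JM KM] fM.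
  have : diag (of_mx M) = 0.
    rewrite -(poly_rV_K (leq_trans (size_diag dM) nN)) -/(f M) fM.
    exact: linear0.
  case/diag_eq0 => g' eg.
  have dg' : deg_lt n.-1 g'.
    by have [_ _ dl] := linear_form_hline R; apply: dl; rewrite -eg.
  have dg'N : deg_lt N g' by apply: deg_lt_mono dg'; lia.
  exists (to_mx N g'); last by rewrite /h to_mxK // -eg of_mxK.
  apply/U'P; rewrite to_mxK //; split=> //.
    by rewrite exprSr -mulrA -eg.
  by move: KM; rewrite eg tauM tau_hline exprSr -mulrA.
- move=> M /UP CM; have /dvdpP[r er] := dvdp_double_zero tjs CM.
  exists (poly_rV r); rewrite /f /g poly_rV_K ?er 1?mulrC //.
  have [->|nr] := eqVneq r 0; first by rewrite size_poly0.
  have [dM _ _] := CM; have := size_diag dM; rewrite er.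
  rewrite size_mul ?double_zero_neq0 // size_double_zero addnS /=.
  by move=> ?; rewrite leq_subRL // addnC.
Qed.

(** Here j = 2 s - l, so l counts the restrictions still to be made before h^(2 s) is reached. The
    restriction made at stage l uses t = floor(l / 2) and contributes e + (l mod 2); these parities
    add up to [uphalf l]. *)
Lemma dim_colon_le s e l (U : {vspace 'M[R]_N}) : (e + l <= N)%N ->
  (l <= 2 * s)%N ->
  (forall M, M \in U <-> colon s (e + l) (2 * s - l) (of_mx M)) ->
  (\dim U <= 'C(e.+1, 2) + l * e + uphalf l)%N.
Proof.
elim: l U => [|l IHl] U elN ls UP.
  have [V VP] := subspace_vspace N (@subspace_deg_lt R e).
  rewrite mul0n !addn0 -(dim_deg_lt _ VP); last by lia.
  by apply/dimvS/subvP => M /UP[dM _ _]; apply/VP; rewrite -[e]addn0.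
have [U' U'P] := subspace_vspace N (subspace_colon s (e + l) (2 * s - l)).
have le1 : (e + l <= N)%N by lia.
have le2 : (l <= 2 * s)%N by lia.
have IH := IHl U' le1 le2 U'P.
have := @dim_colon_step s (e + l.+1) (2 * s - l.+1) (l.+1)./2 U U' elN.
rewrite addnS /= => step.
have {step} : (\dim U <= \dim U' + ((e + l).+1 - 2 * (l.+1)./2))%N.
  apply: step => //.
  - by have := odd_double_half l.+1; lia.
  - by have := odd_double_half l.+1; lia.
  - by move=> M; rewrite -addnS; apply: UP.
  - by move=> M; rewrite -subSn // subSS; apply: U'P.
move: IH; rewrite /= !uphalf_half; have := odd_double_half l.
by case: (odd l) => /=; lia.
Qed.

End ColonSpaces.

(** * Lower bound by counting conditions, and the exact dimension *)

Section ColonDimension.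
Variable R : numFieldType.
Variable N : nat.
Implicit Types (f g : {poly {poly R}}) (n s k j e l m : nat).

(* The conditions imposed on the component of degree [k] by the requirement
   that [hline ^+ s * f] lie in the ideal of the [s]-th powers. *)
Definition gr_cond s k f :=
  forall u, (k < u)%N -> (u < s)%N -> ((1 - 'X) ^+ s * gr k f)`_u = 0.

Lemma gr_linear k (c : R) f g : gr k (c%:P%:P * f + g) = c *: gr k f + gr k g.
Proof.
apply/polyP => u; rewrite coefD coefZ !coef_gr.
by case: ifP => _; rewrite ?mulr0 ?addr0 // !coefD !coefCM.
Qed.

Lemma gr_cond_linear s k (c : R) f g :
  gr_cond s k f -> gr_cond s k g -> gr_cond s k (c%:P%:P * f + g).
Proof.
move=> Cf Cg u u1 u2; rewrite gr_linear mulrDr -scalerAr coefD coefZ.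
by rewrite Cf // Cg // mulr0 addr0.
Qed.

(** A monomial outside the ideal has degree at most 2 s - 2, and h^s f starts in degree s, so the
    components of f of degree below s - 1 decide membership. *)
Lemma gr_cond_in_powers s f : (forall k, (k < s.-1)%N -> gr_cond s k f) ->
  in_powers s (hline R ^+ s * f).
Proof.
move=> C i j si sj.
have -> : (hline R ^+ s * f)`_i`_j = (gr (i + j) (hline R ^+ s * f))`_j.
  by rewrite coef_gr leq_addl addnK.
case: (ltnP (i + j) s) => ij; first by rewrite gr_hlineX_lt // coef0.
by rewrite -(subnKC ij) gr_hlineX C //; lia.
Qed.

(** The conditions at both vertices are imposed one degree at a time, from all polynomials at m = 0
    down to a subspace of the colon space at m = s - 1. *)
Definition filt s n m f :=
  deg_lt n f /\ forall k, (k < m)%N -> gr_cond s k f /\ gr_cond s k (tau 2 f).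

Lemma subspace_filt s n m : subspace (filt s n m).
Proof.
have C0 k : gr_cond s k 0.
  move=> u _ _; rewrite (deg_lt_gr (@deg_lt_zero R 0)) ?mulr0 ?coef0 //.
split.
  by split=> [|k _]; [apply: deg_lt_zero|rewrite tau0].
move=> c f g [df Cf] [dg Cg]; split; first by apply: deg_ltD => //;
  apply: deg_ltCM.
move=> k km; have [Cf1 Cf2] := Cf k km; have [Cg1 Cg2] := Cg k km.
by split; [|rewrite tau_linear]; apply: gr_cond_linear.
Qed.

Lemma dim_filt_step s n m (U U' : {vspace 'M[R]_N}) :
  (forall M, M \in U <-> filt s n m (of_mx M)) ->
  (forall M, M \in U' <-> filt s n m.+1 (of_mx M)) ->
  (\dim U <= \dim U' + 2 * minn m.+1 (s.-1 - m))%N.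
Proof.
move=> UP U'P; set d := minn _ _.
(* In degree m there are s - 1 - m conditions at each vertex. When the component has no more than
   that many coefficients, namely m + 1, all of it is set to zero instead. *)
pose phi f : 'rV[R]_d := \row_i (if (m.+1 <= s.-1 - m)%N then (gr m f)`_i
  else ((1 - 'X) ^+ s * gr m f)`_(m.+1 + i)).
have phi_lin c f g : phi (c%:P%:P * f + g) = c *: phi f + phi g.
  apply/rowP => i; rewrite !mxE gr_linear; case: ifP => _.
    by rewrite coefD coefZ.
  by rewrite mulrDr -scalerAr coefD coefZ.
have phi0 f : phi f = 0 -> gr_cond s m f.
  move=> /rowP p0 u mu us; case: (leqP m.+1 (s.-1 - m)) => le.
    suff -> : gr m f = 0 by rewrite mulr0 coef0.
    apply/polyP => v; rewrite coef0; case: (ltnP v d) => vd.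
      by have := p0 (Ordinal vd); rewrite !mxE le.
    by rewrite coef_gr ifF //; move: vd; rewrite /d; lia.
  have ud : (u - m.+1 < d)%N by rewrite /d; lia.
  by have := p0 (Ordinal ud); rewrite !mxE leqNgt le /= subnKC.
pose f (M : 'M[R]_N) : 'rV[R]_(d + d) :=
  row_mx (phi (of_mx M)) (phi (tau 2 (of_mx M))).
have -> : (2 * d)%N =
  \dim {: 'rV[R]_(d + d)} by rewrite dimvf /dim /= mul1n addnn -mul2n.
apply: (@dimv_ker_le _ _ _ U U' f).
- move=> c M M'; rewrite /f of_mx_linear tau_linear !phi_lin.
  by rewrite scale_row_mx add_row_mx.
- move=> M /UP[dM CM] fM; apply/U'P; split=> // k.
  rewrite ltnS leq_eqVlt => /orP[/eqP->|/CM //].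
  move: fM; rewrite /f -row_mx0 => /eq_row_mx[f1 f2].
  by split; apply: phi0.
Qed.

Lemma dim_filt_ge s n m (U : {vspace 'M[R]_N}) : (n <= N)%N ->
  (forall M, M \in U <-> filt s n m (of_mx M)) ->
  ('C(n.+1, 2) <= \dim U + 2 * \sum_(k < m) minn k.+1 (s.-1 - k))%N.
Proof.
move=> nN; elim: m U => [|m IHm] U UP.
  rewrite big_ord0 addn0 (dim_deg_lt nN (U := U)) // => M.
  by split=> [/UP[]//|dM]; apply/UP; split.
have [V VP] := subspace_vspace N (subspace_filt s n m).
have := IHm V VP; have := dim_filt_step VP UP.
by rewrite big_ord_recr /=; lia.
Qed.

(** The sum is floor(s^2 / 4). From s to s + 2: dropping the two end terms, both equal to 1 for s >
    0, and lowering the others by one leaves the sum for s. *)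
Lemma sum_minn s :
  (4 * (\sum_(k < s.-1) minn k.+1 (s.-1 - k)) + odd s = s * s)%N.
Proof.
elim/ltn_ind: s => -[|[|s]] IHs; rewrite ?big_ord0 //=.
have {IHs} := IHs s (leqnSn _); rewrite negbK.
case: s => [|s]; first by rewrite big_ord_recl !big_ord0.
rewrite big_ord_recl [in X in _ -> X]big_ord_recr /=.
have -> : (\sum_(i < s) minn (bump 0 i).+1 (s.+2 - bump 0 i) =
    \sum_(i < s) (1 + minn i.+1 (s - i)))%N.
  by apply: eq_bigr => k _; rewrite /bump /=; have := ltn_ord k; lia.
by rewrite big_split /= sum1_card card_ord /bump /=; lia.
Qed.

Lemma bin2S n : ('C(n.+1, 2) * 2 = n.+1 * n)%N.
Proof. by rewrite bin2 /= muln2 halfK oddM /=; case: odd => /=;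
  rewrite subn0. Qed.

(** The lower bound is C(e + s + 1, 2) - 2 floor(s^2 / 4), polynomials minus conditions at two
    vertices; for both parities of s it equals the upper bound at l = s. *)
Lemma dim_colon s e (U : {vspace 'M[R]_N}) : (e + s <= N)%N ->
  (forall M, M \in U <-> colon s (e + s) s (of_mx M)) ->
  (\dim U = 'C(e.+1, 2) + s * e + uphalf s)%N.
Proof.
move=> esN UP; apply/eqP; rewrite eqn_leq; apply/andP; split.
  apply: (@dim_colon_le _ _ s _ _ _ esN); first by lia.
  by move=> M; rewrite mul2n -addnn addnK.
have [V VP] := subspace_vspace N (subspace_filt s (e + s) s.-1).
have dVU : (\dim V <= \dim U)%N.
  apply/dimvS/subvP => M /VP[dM CM]; apply/UP; split=> //.
    by apply: gr_cond_in_powers => k /CM[].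
  by apply: gr_cond_in_powers => k /CM[].
have := dim_filt_ge esN VP; have := sum_minn s; have := bin2S (e + s).
have := bin2S e; rewrite uphalf_half; have := odd_double_half s.
by set S := (\sum_(k < _) _)%N; case: (odd s) => /=; lia.
Qed.

End ColonDimension.

(** * Compatible families of eight polynomials and their parametrization *)

Section Compatibility.
Variable R : numFieldType.
Notation A := {poly {poly R}}.
Implicit Types (f g l : A) (n s i j : nat).

Notation la := ('X%:P : A).
Notation lb := ('X : A).
Notation lc := (('X - 2%:P)%:P : A).
Notation le := ('X - 2%:P%:P : A).
Notation lh := (hline R).

(* The triangles [T_1], ..., [T_8] are numbered from 0; the third argument is
   the line carrying the common edge, in the coordinates [a = x + y - 2]
   (inner variable) and [b = x - y] (outer variable). *)
Inductive interior_edge : nat -> nat -> A -> Prop :=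
| edge01 : interior_edge 0 1 lb
| edge15 : interior_edge 1 5 lh
| edge56 : interior_edge 5 6 la
| edge67 : interior_edge 6 7 lb
| edge70 : interior_edge 7 0 la
| edge12 : interior_edge 1 2 lc
| edge23 : interior_edge 2 3 le
| edge34 : interior_edge 3 4 lc
| edge45 : interior_edge 4 5 le.

Definition compat s (q : nat -> A) :=
  forall i j l, interior_edge i j l -> exists w, q i - q j = l ^+ s * w.

Lemma linear_form_la : linear_form la.
Proof. by have := linear_formXi (0 : R); rewrite subr0. Qed.

Lemma linear_form_lb : linear_form lb.
Proof.
have := @linear_formX R 0; rewrite subr0; apply.
by rewrite size_poly0.
Qed.

Lemma linear_form_lc : linear_form lc.
Proof. exact: linear_formXi. Qed.

Lemma linear_form_le : linear_form le.
Proof. by apply: linear_formX; rewrite size_polyC; case: eqP. Qed.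

Lemma tau_lc : tau 2 lc = la.
Proof.
rewrite (_ : lc = la - 2%:P%:P); last exact: polyCB.
by rewrite tauB tauXi tauC addrK.
Qed.

Lemma tau_le : tau 2 le = lb.
Proof. by rewrite tauB tauX tauC addrK. Qed.

Lemma tauN_la : tau (-2) la = lc.
Proof. by rewrite -[RHS](tauK 2) tau_lc. Qed.

Lemma tauN_lb : tau (-2) lb = le.
Proof. by rewrite -[RHS](tauK 2) tau_le. Qed.

Definition quoC s g := tau (-2) (quoA s (tau 2 g)).
Definition quoE s g := tau (-2) (quoB s (tau 2 g)).

Lemma in_powersE2 s g : in_powers s (tau 2 g) ->
  g = lc ^+ s * quoC s g + le ^+ s * quoE s g.
Proof.
move=> /in_powersE; move/(congr1 (tau (-2))); rewrite tauK => {1}->.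
by rewrite tauD !tauM !tauXn tauN_la tauN_lb.
Qed.

Lemma powers_syzygy2 s f g : lc ^+ s * f + le ^+ s * g = 0 ->
  exists w, f = le ^+ s * w /\ g = lc ^+ s * - w.
Proof.
move/(congr1 (tau 2)); rewrite tau0 tauD !tauM !tauXn tau_lc tau_le.
case/powers_syzygy => w [fw gw]; exists (tau (-2) w).
rewrite -[f](tauK 2) fw -[g](tauK 2) gw mulrN; split.
  by rewrite tauM tauXn tauN_lb.
by rewrite tauN tauM tauXn tauN_la.
Qed.

(* [w 0] is the restriction to [T_6], [w 7] is the quotient by [lh ^+ s] of the
   jump from [T_6] to [T_2], [w 5] and [w 6] are syzygies, and [w 1], ..., [w 4]
   are the free jumps across the edges from [T_6] to [T_7], [T_7] to [T_8],
   [T_6] to [T_5] and [T_5] to [T_4]. *)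
Definition spline_of s (w : nat -> A) (i : nat) : A :=
  let F := w 0%N in
  match i with
  | 0 => F + la ^+ s * quoA s (lh ^+ s * w 7%N) + la ^+ s * (lb ^+ s * w 5%N)
         + lb ^+ s * w 2%N
  | 1 => F + lh ^+ s * w 7%N
  | 2 => F + le ^+ s * quoE s (lh ^+ s * w 7%N) + le ^+ s * (lc ^+ s * w 6%N)
         + lc ^+ s * w 4%N
  | 3 => F + le ^+ s * w 3%N + lc ^+ s * w 4%N
  | 4 => F + le ^+ s * w 3%N
  | 5 => F
  | 6 => F + la ^+ s * w 1%N
  | 7 => F + la ^+ s * w 1%N + lb ^+ s * w 2%N
  | _ => 0
  end.

Definition parameter s n (i : nat) : A -> Prop :=
  match i with
  | 0 => deg_lt n
  | 1 | 2 | 3 | 4 => deg_lt (n - s)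
  | 5 | 6 => deg_lt (n - s - s)
  | _ => colon s (n - s) s
  end.

Lemma hline_tau s g : lh ^+ s * tau 2 g = tau 2 (lh ^+ s * g).
Proof. by rewrite tauM tauXn tau_hline. Qed.

(** Around each interior vertex every jump but one is divisible by construction. The exceptions,
    across the edges 01 and 12, are divisible because h^s w 7 decomposes in the ideal of that
    vertex. *)
Lemma compat_spline_of s n w : (forall i, (i < 8)%N -> parameter s n i (w i)) ->
  compat s (spline_of s w).
Proof.
move=> P; have [dg Jg Kg] := P 7%N isT.
have gA := in_powersE Jg; rewrite hline_tau in Kg; have gE := in_powersE2 Kg.
move: gA gE; set G := lh ^+ s * w 7%N => gA gE.
move=> i j l []; rewrite /= -/G.
- exists (w 2%N + la ^+ s * w 5%N - quoB s G); rewrite [X in _ - (_ + X)]gA;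
  ring.
- exists (w 7%N); rewrite /G; ring.
- exists (- w 1%N); ring.
- exists (- w 2%N); ring.
- exists (w 1%N - quoA s G - lb ^+ s * w 5%N); ring.
- exists (quoC s G - le ^+ s * w 6%N - w 4%N); rewrite [X in _ + X - _]gE; ring.
- exists (quoE s G + lc ^+ s * w 6%N - w 3%N); ring.
- exists (w 4%N); ring.
- exists (w 3%N); ring.
Qed.

Lemma deg_lt_pow_mull l n s f : linear_form l -> (s <= n)%N ->
  deg_lt (n - s) f -> deg_lt n (l ^+ s * f).
Proof. by move=> ll sn df; rewrite -(subnKC sn); apply: deg_lt_mull. Qed.

Lemma deg_lt_spline_of s n w : (2 * s <= n)%N ->
  (forall i, (i < 8)%N -> parameter s n i (w i)) ->
  forall i, deg_lt n (spline_of s w i).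
Proof.
move=> sn P.
have [s1 s2] : (s <= n)%N /\ (s <= n - s)%N by lia.
have d0 : deg_lt n (w 0%N) := P 0%N isT.
have d1 : deg_lt (n - s) (w 1%N) := P 1%N isT.
have d2 : deg_lt (n - s) (w 2%N) := P 2%N isT.
have d3 : deg_lt (n - s) (w 3%N) := P 3%N isT.
have d4 : deg_lt (n - s) (w 4%N) := P 4%N isT.
have d5 : deg_lt (n - s - s) (w 5%N) := P 5%N isT.
have d6 : deg_lt (n - s - s) (w 6%N) := P 6%N isT.
have [dg _ _] := P 7%N isT.
have dG : deg_lt n (lh ^+ s * w 7%N).
  by apply: deg_lt_pow_mull => //; apply: linear_form_hline.
have [Fa Fb Fc Fe] :=
  And4 linear_form_la linear_form_lb linear_form_lc linear_form_le.
move=> [|[|[|[|[|[|[|[|i]]]]]]]] /=;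
  do ?[exact: d0 | apply: deg_ltD => // | exact: deg_lt_zero
      | apply: deg_lt_pow_mull => //].
  exact: deg_lt_quoA.
by apply: deg_lt_tau; apply: deg_lt_quoB; apply: deg_lt_tau.
Qed.

Lemma linear_form_exp_neq0 l s : linear_form l -> l ^+ s != 0.
Proof. by case=> nl _ _; apply: expf_neq0. Qed.

(** The parametrization is triangular: T_6, T_7, T_8, T_5, T_4, T_2 give the parameters 0, 1, 2, 3,
    4, 7 in turn, after which T_1 and T_3 retain only the syzygy terms. *)
Lemma spline_of_eq0 s w : (forall i, (i < 8)%N -> spline_of s w i = 0) ->
  forall i, (i < 8)%N -> w i = 0.
Proof.
move=> q0.
have cancel0 l f : linear_form l -> l ^+ s * f = 0 -> f = 0.
  by move=> /linear_form_exp_neq0 nl /eqP;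
    rewrite mulf_eq0 (negbTE (nl s)) => /eqP.
have [Fa Fb Fc Fe] :=
  And4 linear_form_la linear_form_lb linear_form_lc linear_form_le.
have w0 : w 0%N = 0 := q0 5%N isT.
have w1 : w 1%N = 0 by have := q0 6%N isT; rewrite /= w0 add0r; apply: cancel0.
have w2 : w 2%N = 0.
  by have := q0 7%N isT; rewrite /= w0 w1 mulr0 !add0r; apply: cancel0.
have w3 : w 3%N = 0 by have := q0 4%N isT; rewrite /= w0 add0r; apply: cancel0.
have w4 : w 4%N = 0.
  by have := q0 3%N isT; rewrite /= w0 w3 mulr0 !add0r; apply: cancel0.
have w7 : w 7%N = 0.
  have := q0 1%N isT; rewrite /= w0 add0r; apply: cancel0.
  exact: linear_form_hline.
have qA0 : quoA s (0 : A) = 0.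
  by apply: deg_lt0; have := @deg_lt_quoA R s 0 0 (@deg_lt_zero R 0);
    rewrite sub0n.
have qB0 : quoB s (0 : A) = 0.
  by apply: deg_lt0; have := @deg_lt_quoB R s 0 0 (@deg_lt_zero R 0);
    rewrite sub0n.
have w5 : w 5%N = 0.
  have := q0 0%N isT; rewrite /= w0 w7 w2 !mulr0 qA0 mulr0 !add0r addr0.
  by move/(cancel0 _ _ Fa); apply: cancel0.
have w6 : w 6%N = 0.
  have := q0 2%N isT;
    rewrite /= w0 w7 w4 !mulr0 /quoE tau0 qB0 tau0 mulr0 !add0r addr0.
  by move/(cancel0 _ _ Fe); apply: cancel0.
by move=> [|[|[|[|[|[|[|[|i]]]]]]]].
Qed.

Lemma compat_spline_ofP s n q : (2 * s <= n)%N ->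
  (forall i, (i < 8)%N -> deg_lt n (q i)) -> compat s q ->
  exists w, (forall i, (i < 8)%N -> parameter s n i (w i)) /\
    forall i, (i < 8)%N -> q i = spline_of s w i.
Proof.
move=> sn dq C.
have quo i j l : interior_edge i j l -> linear_form l -> (i < 8)%N ->
  (j < 8)%N ->
    exists2 u, deg_lt (n - s) u & q i - q j = l ^+ s * u.
  move=> /C[u qu] ll i8 j8; exists u => //; apply: (deg_lt_divl ll).
  by rewrite -qu; apply: deg_ltB; apply: dq.
have [Fa Fb Fc Fe] :=
  And4 linear_form_la linear_form_lb linear_form_lc linear_form_le.
have [v1 dv1 e56] := quo _ _ _ edge56 Fa isT isT.
have [v2 dv2 e67] := quo _ _ _ edge67 Fb isT isT.
have [p3 dp3 e45] := quo _ _ _ edge45 Fe isT isT.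
have [p4 dp4 e34] := quo _ _ _ edge34 Fc isT isT.
have [g dg e15] := quo _ _ _ edge15 (linear_form_hline R) isT isT.
have [u1 du1 e70] := quo _ _ _ edge70 Fa isT isT.
have [u2 du2 e01] := quo _ _ _ edge01 Fb isT isT.
have [u3 du3 e12] := quo _ _ _ edge12 Fc isT isT.
have [u4 du4 e23] := quo _ _ _ edge23 Fe isT isT.
set G := lh ^+ s * g in e15.
(* The jumps around an interior vertex sum to zero, so the jump G across the middle edge is minus
   the sum of the others; this puts G in the ideal of each vertex. *)
have GA : G = la ^+ s * (- v1 - u1) + lb ^+ s * (- v2 - u2).
  transitivity ((q 1%N - q 5%N)); first by rewrite e15.
  transitivity (- (q 5%N - q 6%N) - (q 6%N - q 7%N) - (q 7%N - q 0%N)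
    - (q 0%N - q 1%N)); first by ring.
  by rewrite e56 e67 e70 e01; ring.
have GC : G = lc ^+ s * (u3 + p4) + le ^+ s * (u4 + p3).
  transitivity ((q 1%N - q 5%N)); first by rewrite e15.
  transitivity ((q 1%N - q 2%N) + (q 2%N - q 3%N) + (q 3%N - q 4%N)
    + (q 4%N - q 5%N)); first by ring.
  by rewrite e12 e23 e34 e45; ring.
have JG : in_powers s G by rewrite GA; apply: in_powers_comb.
have KG : in_powers s (tau 2 G).
  rewrite GC tauD !tauM !tauXn tau_lc tau_le.
  exact: in_powers_comb.
(* Two decompositions of G in the same ideal, the one from the jumps and the canonical one, differ
   by a syzygy. *)
have [k1 [k1E _]] : exists k1, - v1 - u1 - quoA s G = lb ^+ s * k1 /\
    - v2 - u2 - quoB s G = - (la ^+ s * k1).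
  apply: powers_syzygy; rewrite !mulrBr.
  have := in_powersE JG; rewrite {1}GA => E.
  by apply/eqP; rewrite addrACA -opprD subr_eq0 -!mulrBr; apply/eqP.
have [k2 [_ k2E]] : exists k2, u3 + p4 - quoC s G = le ^+ s * k2 /\
    u4 + p3 - quoE s G = lc ^+ s * - k2.
  apply: powers_syzygy2; rewrite !mulrBr.
  have := in_powersE2 KG; rewrite {1}GC => E.
  by apply/eqP; rewrite addrACA -opprD subr_eq0; apply/eqP.
have dG : deg_lt n G.
  by apply: deg_lt_pow_mull => //; [exact: linear_form_hline|lia].
(* The signs of v1 and v2 change because these jumps were taken towards T_6 and T_7, against the
   direction of [spline_of]. *)
exists (fun i => nth 0 [:: q 5%N; - v1; - v2; p3; p4; k1; - k2; g] i); split.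
  move=> [|[|[|[|[|[|[|[|i]]]]]]]] //= _; try exact: deg_ltN.
  - exact: dq.
  - apply: (deg_lt_divl Fb); rewrite -k1E.
    apply: deg_ltB; last exact: deg_lt_quoA.
    by apply: deg_ltB => //; apply: deg_ltN.
  - apply: (deg_lt_divl Fc); rewrite -k2E.
    apply: deg_ltB; first exact: deg_ltD.
    by apply: deg_lt_tau; apply: deg_lt_quoB; apply: deg_lt_tau.
  - by split=> //; rewrite hline_tau.
have q6 : q 6%N = q 5%N + la ^+ s * - v1 by rewrite mulrN -e56; ring.
have q7 : q 7%N = q 6%N + lb ^+ s * - v2 by rewrite mulrN -e67; ring.
have q4 : q 4%N = q 5%N + le ^+ s * p3 by rewrite -e45; ring.
have q3 : q 3%N = q 4%N + lc ^+ s * p4 by rewrite -e34; ring.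
move=> [|[|[|[|[|[|[|[|i]]]]]]]] //= _.
- rewrite -/G -k1E; transitivity (q 7%N - (q 7%N - q 0%N)); first by ring.
  by rewrite e70 q7 q6; ring.
- by rewrite -/G -e15; ring.
- rewrite -/G -k2E; transitivity (q 3%N + (q 2%N - q 3%N)); first by ring.
  by rewrite e23 q3 q4; ring.
- by rewrite q3 q4.
- by rewrite q7 q6.
Qed.

End Compatibility.

Local Open Scope classical_set_scope.
Local Open Scope ring_scope.

(** * Evaluation at points of the plane and partial derivatives *)

Section Evaluation.
Variable R : realType.
Notation A := {poly {poly R}}.
Implicit Types (f g l w : A) (p v : R * R).

Lemma poly2_closed_ind (P : A -> Prop) :
  (forall c : R, P c%:P%:P) -> P 'X%:P -> P 'X ->
  (forall f g, P f -> P g -> P (f + g)) ->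
  (forall f g, P f -> P g -> P (f * g)) -> forall f, P f.
Proof.
move=> PC PXi PX Padd Pmul f.
have P0 : P 0 by exact: (PC 0).
have Pexp g n : P g -> P (g ^+ n).
  move=> Pg; elim: n => [|n IHn]; first exact: (PC 1).
  by rewrite exprS; apply: Pmul.
rewrite [f]polyXiE; apply: (big_ind P) => // i _.
apply: (big_ind P) => // j _.
by apply: (Pmul) => //; apply: (Pmul); apply: Pexp.
Qed.

Definition coord_a p : R := p.1 + p.2 - 2.
Definition coord_b p : R := p.1 - p.2.
Definition ev p f : R := f.[(coord_b p)%:P].[coord_a p].

Lemma evC p (c : R) : ev p c%:P%:P = c. Proof. by rewrite /ev !hornerC. Qed.
Lemma evXi p : ev p 'X%:P = coord_a p. Proof.
by rewrite /ev hornerC hornerX. Qed.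
Lemma evX p : ev p 'X = coord_b p. Proof. by rewrite /ev hornerX hornerC. Qed.
Lemma evD p f g : ev p (f + g) = ev p f + ev p g. Proof.
by rewrite /ev !hornerD. Qed.
Lemma evN p f : ev p (- f) = - ev p f. Proof. by rewrite /ev !hornerN. Qed.
Lemma evB p f g : ev p (f - g) = ev p f - ev p g. Proof.
by rewrite evD evN. Qed.
Lemma evM p f g : ev p (f * g) = ev p f * ev p g. Proof.
by rewrite /ev !hornerM. Qed.
Lemma evXn p f n : ev p (f ^+ n) = ev p f ^+ n. Proof.
by rewrite /ev !horner_exp. Qed.

Lemma continuous_ev f : continuous (fun p => ev p f).
Proof.
elim/poly2_closed_ind: f => [c|||f g cf cg|f g cf cg] p.
- under eq_fun do rewrite evC; exact: cvg_cst.
- under eq_fun do rewrite evXi; apply: cvgB; last exact: cvg_cst.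
  by apply: cvgD; [exact: cvg_fst|exact: cvg_snd].
- under eq_fun do rewrite evX; apply: cvgB; [exact: cvg_fst|exact: cvg_snd].
- under eq_fun do rewrite evD; apply: cvgD; [exact: cf|exact: cg].
- under eq_fun do rewrite evM; apply: cvgM; [exact: cf|exact: cg].
Qed.

(** Differentiation in a acts on coefficients, a being the inner variable; [deriv] on the outer
    polynomial differentiates in b. *)
Definition pda f : A := map_poly (@deriv R) f.

Lemma coef_pda f i : (pda f)`_i = (f`_i)^`().
Proof. by rewrite coef_map_id0 ?deriv0. Qed.

Lemma pdaD f g : pda (f + g) = pda f + pda g.
Proof. by apply/polyP => i; rewrite coefD !coef_pda coefD derivD. Qed.

Lemma pdaM f g : pda (f * g) = pda f * g + f * pda g.
Proof.
apply/polyP => i; rewrite coefD coef_pda !coefM raddf_sum -big_split /=.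
by apply: eq_bigr => j _; rewrite derivM !coef_pda.
Qed.

(* The partial derivatives with respect to the original coordinates. *)
Definition pdx f : A := pda f + f^`().
Definition pdy f : A := pda f - f^`().

Lemma pdyD f g : pdy (f + g) = pdy f + pdy g.
Proof. by rewrite /pdy pdaD derivD; ring. Qed.
Lemma pdyM f g : pdy (f * g) = pdy f * g + f * pdy g.
Proof. by rewrite /pdy pdaM derivM; ring. Qed.
Lemma pdxD f g : pdx (f + g) = pdx f + pdx g.
Proof. by rewrite /pdx pdaD derivD; ring. Qed.
Lemma pdxM f g : pdx (f * g) = pdx f * g + f * pdx g.
Proof. by rewrite /pdx pdaM derivM; ring. Qed.

Lemma pdaPC (u : {poly R}) : pda u%:P = u^`()%:P.
Proof.
by apply/polyP => i; rewrite coef_pda !coefC; case: eqP; rewrite ?deriv0.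
Qed.
Lemma pdaC (c : R) : pda c%:P%:P = 0.
Proof. by rewrite pdaPC derivC. Qed.
Lemma pdaXi : pda 'X%:P = 1.
Proof. by rewrite pdaPC derivX. Qed.
Lemma pdaX : pda 'X = 0.
Proof. by apply/polyP => i; rewrite coef_pda coefX coef0; case: eqP;
  rewrite ?deriv0 // derivC. Qed.

Lemma pdyC (c : R) : pdy c%:P%:P = 0. Proof.
by rewrite /pdy pdaC derivC subr0. Qed.
Lemma pdyXi : pdy 'X%:P = 1. Proof. by rewrite /pdy pdaXi derivC subr0. Qed.
Lemma pdyX : pdy 'X = -1. Proof. by rewrite /pdy pdaX derivX sub0r. Qed.
Lemma pdxC (c : R) : pdx c%:P%:P = 0. Proof.
by rewrite /pdx pdaC derivC addr0. Qed.
Lemma pdxXi : pdx 'X%:P = 1. Proof. by rewrite /pdx pdaXi derivC addr0. Qed.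
Lemma pdxX : pdx 'X = 1. Proof. by rewrite /pdx pdaX derivX add0r. Qed.

Lemma is_derive_fst p v : is_derive p v (fst : R * R -> R) v.1.
Proof.
have E : (fun h : R => h^-1 *: ((fst \o shift p) (h *: v) - fst p)) @ 0^'
    --> (v.1 : R).
  apply/cvgrPdist_lt => e e0; near=> h.
  have h0 : h != 0 by near: h; exact: nbhs_dnbhs_neq.
  by rewrite /= addrK scalerA mulVf // scale1r subrr normr0.
by apply: DeriveDef; [apply/cvg_ex; exists v.1|exact: cvg_lim].
Unshelve. all: by end_near.
Qed.

Lemma is_derive_snd p v : is_derive p v (snd : R * R -> R) v.2.
Proof.
have E : (fun h : R => h^-1 *: ((snd \o shift p) (h *: v) - snd p)) @ 0^'
    --> (v.2 : R).
  apply/cvgrPdist_lt => e e0; near=> h.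
  have h0 : h != 0 by near: h; exact: nbhs_dnbhs_neq.
  by rewrite /= addrK scalerA mulVf // scale1r subrr normr0.
by apply: DeriveDef; [apply/cvg_ex; exists v.2|exact: cvg_lim].
Unshelve. all: by end_near.
Qed.

(** Directional derivatives obey the sum and product rules, as D does, so agreement on constants, a
    and b suffices. *)
Lemma is_derive_ev (D : A -> A) p v :
  (forall f g, D (f + g) = D f + D g) ->
  (forall f g, D (f * g) = D f * g + f * D g) ->
  (forall c : R, D c%:P%:P = 0) ->
  ev p (D 'X%:P) = v.1 + v.2 -> ev p (D 'X) = v.1 - v.2 ->
  forall f, is_derive p v (fun q => ev q f) (ev p (D f)).
Proof.
move=> DD DM DC DXi DX.
have d1 := is_derive_fst p v; have d2 := is_derive_snd p v.
elim/poly2_closed_ind => [c|||f g df dg|f g df dg].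
- rewrite DC (_ : ev p 0 = 0); last exact: (evC p 0).
  under eq_fun do rewrite evC; exact: is_derive_cst.
- rewrite DXi; under eq_fun do rewrite evXi.
  rewrite -[_ + _]subr0.
  exact: (is_deriveB (is_deriveD d1 d2) (is_derive_cst (2 : R) p v)).
- rewrite DX; under eq_fun do rewrite evX.
  exact: (is_deriveB d1 d2).
- rewrite DD evD; under eq_fun do rewrite evD; exact: is_deriveD.
- rewrite DM evD !evM; under eq_fun do rewrite evM.
  apply: (is_derive_eq (is_deriveM df dg)).
  by rewrite /GRing.scale /= [_ * ev p g]mulrC addrC.
Qed.

Lemma is_derive_evx p f :
  is_derive p ((1, 0) : R * R) (fun q => ev q f) (ev p (pdx f)).
Proof.
apply: is_derive_ev; [exact: pdxD|exact: pdxM|exact: pdxC| |].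
  by rewrite pdxXi (evC p 1) addr0.
by rewrite pdxX (evC p 1) subr0.
Qed.

Lemma is_derive_evy p f :
  is_derive p ((0, 1) : R * R) (fun q => ev q f) (ev p (pdy f)).
Proof.
apply: is_derive_ev; [exact: pdyD|exact: pdyM|exact: pdyC| |].
  by rewrite pdyXi (evC p 1) add0r.
by rewrite pdyX evN (evC p 1) sub0r.
Qed.

End Evaluation.

(** * The triangles of [Delta_S] and the gluing of polynomial pieces *)

Section Geometry.
Variable R : realType.
Notation A := {poly {poly R}}.
Implicit Types (f g l w : A) (p v : R * R) (i j k : nat) (q : nat -> A).

Definition aff (u : R * R * R) p : R := u.1.1 * p.1 + u.1.2 * p.2 + u.2.

(* The barycentric coordinates in the [i]-th triangle of [Delta_S], as affine
   functions of the point. *)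
Definition bary (i k : nat) : R * R * R :=
  let h := 2^-1 in
  match i, k with
  | 0, 0 => (- h, h, 0)   | 0, 1 => (h, h, -1)     | 0, _ => (0, -1, 2)
  | 1, 0 => (0, 1, -1)    | 1, 1 => (- h, - h, 2)  | 1, _ => (h, - h, 0)
  | 2, 0 => (- h, h, 1)   | 2, 1 => (h, h, -2)     | 2, _ => (0, -1, 2)
  | 3, 0 => (h, h, -2)    | 3, 1 => (h, - h, -1)   | 3, _ => (-1, 0, 4)
  | 4, 0 => (h, - h, -1)  | 4, 1 => (- h, - h, 2)  | 4, _ => (0, 1, 0)
  | 5, 0 => (0, -1, 1)    | 5, 1 => (- h, h, 1)    | 5, _ => (h, h, -1)
  | 6, 0 => (h, - h, 0)   | 6, 1 => (- h, - h, 1)  | 6, _ => (0, 1, 0)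
  | _, 0 => (- h, - h, 1) | _, 1 => (- h, h, 0)    | _, _ => (1, 0, 0)
  end.

Definition in_tri i p := [&& 0 <= aff (bary i 0) p, 0 <= aff (bary i 1) p
  & 0 <= aff (bary i 2) p].
Definition in_open_tri i p := [&& 0 < aff (bary i 0) p, 0 < aff (bary i 1) p
  & 0 < aff (bary i 2) p].

Lemma lt8_ind (P : nat -> Prop) : P 0%N -> P 1%N -> P 2%N -> P 3%N -> P 4%N ->
  P 5%N -> P 6%N -> P 7%N -> forall i, (i < 8)%N -> P i.
Proof. by move=> ? ? ? ? ? ? ? ? [|[|[|[|[|[|[|[|i]]]]]]]]. Qed.

Definition tri i : triangle R := nth ((0, 0), (0, 0), (0, 0)) (Delta_S R) i.

Lemma tri_setP i p : (i < 8)%N -> tri_set (tri i) p <-> in_tri i p.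
Proof.
move: i; apply: lt8_ind; rewrite /in_tri /aff /tri /=; split.
all: try (case=> a [b [c [a0 b0 c0 abc ->]]] /=; apply/and3P; split; lra).
all: case/and3P; case: p => x y /= h0 h1 h2.
all: do 3 eexists; split; [exact: h0|exact: h1|exact: h2|lra|].
all: congr pair; lra.
Qed.

Lemma realizationP p : realization (Delta_S R) p <->
  exists2 i, (i < 8)%N & in_tri i p.
Proof.
split=> [[T /(nthP (tri 8)) [i i8 <-]] Tp|[i i8 /(tri_setP _ i8) Tp]].
  by exists i => //; apply/tri_setP => //.
by exists (tri i) => //; apply/(nthP (tri 8)); exists i.
Qed.

(** On shared edges the first triangle of the list is chosen; off the realization the value is 8. *)
Definition tri_index p : nat := find (in_tri^~ p) (iota 0 8).

Lemma tri_indexP p : realization (Delta_S R) p ->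
  (tri_index p < 8)%N /\ in_tri (tri_index p) p.
Proof.
move/realizationP => [i i8 Tp].
have H : has (in_tri^~ p) (iota 0 8) by apply/hasP; exists i; rewrite ?mem_iota.
have lt8 : (tri_index p < 8)%N by rewrite -[8%N](size_iota 0) -has_find.
by split=> //; have := nth_find 0%N H; rewrite nth_iota.
Qed.

Definition glue q p : R := ev p (q (tri_index p)).

Lemma compat_eq s q i j l p : compat s.+1 q -> interior_edge i j l ->
  ev p l = 0 -> ev p (q i) = ev p (q j).
Proof.
move=> C e lp; have [w qw] := C _ _ _ e.
by apply/eqP; rewrite -subr_eq0 -evB qw evM evXn lp expr0n mul0r.
Qed.

(** Two triangles meet in an edge, in a vertex or not at all. At a vertex the equality is chained
    through the triangles around it. The goals run over j, and for each j over i < j. *)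
Lemma agree_on_overlaps (v : nat -> R) p :
  (p.1 - p.2 = 0 -> v 0%N = v 1%N) -> (p.2 = 1 -> v 1%N = v 5%N) ->
  (p.1 + p.2 = 2 -> v 5%N = v 6%N) -> (p.1 - p.2 = 0 -> v 6%N = v 7%N) ->
  (p.1 + p.2 = 2 -> v 7%N = v 0%N) -> (p.1 + p.2 = 4 -> v 1%N = v 2%N) ->
  (p.1 - p.2 = 2 -> v 2%N = v 3%N) -> (p.1 + p.2 = 4 -> v 3%N = v 4%N) ->
  (p.1 - p.2 = 2 -> v 4%N = v 5%N) ->
  forall i j, (i < j < 8)%N -> in_tri i p -> in_tri j p -> v i = v j.
Proof.
case: p => x y /= E01 E15 E56 E67 E70 E12 E23 E34 E45.
rewrite /in_tri /aff; move=> i j /andP[ij j8]; move: i ij.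
move: j j8; apply: lt8_ind; do ?case=> //; rewrite /=;
  move=> _ /and3P[h0 h1 h2] /and3P[k0 k1 k2].
- refine (E01 _); clear - h0 h1 h2 k0 k1 k2; lra.
- refine (etrans (E01 _) (E12 _)); clear - h0 h1 h2 k0 k1 k2; lra.
- refine (E12 _); clear - h0 h1 h2 k0 k1 k2; lra.
- exfalso; clear - h0 h1 h2 k0 k1 k2; lra.
- refine (etrans (E12 _) (E23 _)); clear - h0 h1 h2 k0 k1 k2; lra.
- refine (E23 _); clear - h0 h1 h2 k0 k1 k2; lra.
- exfalso; clear - h0 h1 h2 k0 k1 k2; lra.
- refine (etrans (E15 _) (esym (E45 _))); clear - h0 h1 h2 k0 k1 k2; lra.
- refine (etrans (E23 _) (E34 _)); clear - h0 h1 h2 k0 k1 k2; lra.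
- refine (E34 _); clear - h0 h1 h2 k0 k1 k2; lra.
- refine (etrans (E01 _) (E15 _)); clear - h0 h1 h2 k0 k1 k2; lra.
- refine (E15 _); clear - h0 h1 h2 k0 k1 k2; lra.
- refine (etrans (esym (E12 _)) (E15 _)); clear - h0 h1 h2 k0 k1 k2; lra.
- refine (etrans (E34 _) (E45 _)); clear - h0 h1 h2 k0 k1 k2; lra.
- refine (E45 _); clear - h0 h1 h2 k0 k1 k2; lra.
- refine (etrans (esym (E70 _)) (esym (E67 _))); clear - h0 h1 h2 k0 k1 k2; lra.
- refine (etrans (E15 _) (E56 _)); clear - h0 h1 h2 k0 k1 k2; lra.
- exfalso; clear - h0 h1 h2 k0 k1 k2; lra.
- exfalso; clear - h0 h1 h2 k0 k1 k2; lra.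
- refine (etrans (E45 _) (E56 _)); clear - h0 h1 h2 k0 k1 k2; lra.
- refine (E56 _); clear - h0 h1 h2 k0 k1 k2; lra.
- refine (esym (E70 _)); clear - h0 h1 h2 k0 k1 k2; lra.
- refine (etrans (esym (E01 _)) (esym (E70 _))); clear - h0 h1 h2 k0 k1 k2; lra.
- exfalso; clear - h0 h1 h2 k0 k1 k2; lra.
- exfalso; clear - h0 h1 h2 k0 k1 k2; lra.
- exfalso; clear - h0 h1 h2 k0 k1 k2; lra.
- refine (etrans (E56 _) (E67 _)); clear - h0 h1 h2 k0 k1 k2; lra.
- refine (E67 _); clear - h0 h1 h2 k0 k1 k2; lra.
Qed.

Lemma compat_agree s q i j p : compat s.+1 q -> (i < 8)%N -> (j < 8)%N ->
  in_tri i p -> in_tri j p -> ev p (q i) = ev p (q j).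
Proof.
move=> C i8 j8 Ti Tj.
have evc : p.1 + p.2 = 4 -> ev p ('X - 2%:P)%:P = 0.
  by move=> e; rewrite polyCB evB evXi evC /coord_a e; ring.
have eve : p.1 - p.2 = 2 -> ev p ('X - 2%:P%:P) = 0.
  by move=> e; rewrite evB evX evC /coord_b e subrr.
have eva : p.1 + p.2 = 2 -> ev p 'X%:P = 0.
  by move=> e; rewrite evXi /coord_a e subrr.
have evb : p.1 - p.2 = 0 -> ev p 'X = 0 by rewrite evX.
have evh : p.2 = 1 -> ev p (hline R) = 0.
  by move=> e; rewrite evB evX evXi /coord_a /coord_b e; ring.
have agree := @agree_on_overlaps (fun i => ev p (q i)) p
  (compat_eq C (edge01 R) \o evb) (compat_eq C (edge15 R) \o evh)
  (compat_eq C (edge56 R) \o eva) (compat_eq C (edge67 R) \o evb)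
  (compat_eq C (edge70 R) \o eva) (compat_eq C (edge12 R) \o evc)
  (compat_eq C (edge23 R) \o eve) (compat_eq C (edge34 R) \o evc)
  (compat_eq C (edge45 R) \o eve).
case: (ltngtP i j) => [ij|ji|->] //; first by apply: agree; rewrite ?ij.
by apply/esym/agree; rewrite ?ji.
Qed.

Lemma glueE s q i p : compat s.+1 q -> (i < 8)%N -> in_tri i p ->
  glue q p = ev p (q i).
Proof.
move=> C i8 Tp; have [j8 Tj] : (tri_index p < 8)%N /\ in_tri (tri_index p) p.
  by apply/tri_indexP/realizationP; exists i.
exact: compat_agree C _ _ Tj Tp.
Qed.

Lemma continuous_aff u : continuous (aff u).
Proof.
move=> p; apply: cvgD; last exact: cvg_cst.
by apply: cvgD; apply: cvgM;
  [exact: cvg_cst|exact: cvg_fst|exact: cvg_cst|exact: cvg_snd].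
Qed.

Lemma near_aff_ge0 u p : \forall p' \near p, 0 <= aff u p' -> 0 <= aff u p.
Proof.
case: (leP 0 (aff u p)) => [up|up]; first by near=> p'.
have := @continuous_aff u p => /cvgrPdist_lt /(_ (- aff u p)).
rewrite oppr_gt0 => /(_ up); apply: filterS => p' + p'0.
by rewrite ltr_distlC => /andP[_]; lra.
Unshelve. all: by end_near.
Qed.

Lemma near_ord8 (T : Type) (F : set_system T) {FF : Filter F} (P : nat -> T ->
  Prop) :
  (forall i, \forall x \near F, P i x) ->
  \forall x \near F, forall i, (i < 8)%N -> P i x.
Proof.
move=> H; have : \forall x \near F, forall i : 'I_8, P i x.
  by apply: filter_forall => i; apply: H.
by apply: filterS => x Px i i8; apply: (Px (Ordinal i8)).
Qed.

(** The triangles are closed. Values of [glue] near p can therefore be computed from pieces whose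
    triangle contains p. *)
Lemma near_in_tri p :
  \forall p' \near p, forall i, (i < 8)%N -> in_tri i p' -> in_tri i p.
Proof.
apply: (@near_ord8 _ (nbhs p) _ (fun i p' => in_tri i p' -> in_tri i p)) => i.
apply: filterS3 (near_aff_ge0 (bary i 0) p) (near_aff_ge0 (bary i 1) p)
  (near_aff_ge0 (bary i 2) p) => p' H0 H1 H2 /and3P[h0 h1 h2].
by apply/and3P; split; [exact: H0|exact: H1|exact: H2].
Qed.

Lemma continuous_glue s q : compat s.+1 q ->
  {within realization (Delta_S R), continuous (glue q)}.
Proof.
move=> C; apply/subspace_continuousP => p Dp; apply/cvgrPdist_lt => e e0.
have near_q : \forall p' \near p, forall i, (i < 8)%N ->
  `|ev p (q i) - ev p' (q i)| < e.
  apply: (@near_ord8 _ (nbhs p) _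
    (fun i p' => `|ev p (q i) - ev p' (q i)| < e)) => i.
  by have /cvgrPdist_lt/(_ _ e0) := @continuous_ev R (q i) p.
rewrite near_withinE;
  apply: filterS2 near_q (near_in_tri p) => p' eq_p' Tp' Dp'.
have [i8 Ti] := tri_indexP Dp'.
by rewrite /from_subspace (glueE C i8 (Tp' _ i8 Ti)); apply: eq_p'.
Qed.

Lemma is_derive_quotient (F : R * R -> R) p v (d : R) :
  (fun h : R => h^-1 *: ((F \o shift p) (h *: v) - F p)) @ 0^' --> d ->
  is_derive p v F d.
Proof.
by move=> E; apply: DeriveDef; [apply/cvg_ex; exists d|exact: cvg_lim].
Qed.

(** For small h the difference quotient is that of one of the pieces whose triangle contains p.
    There are finitely many, and the derivatives of all of them at p agree by compatibility of
    [D \o q]. *)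
Lemma is_derive_glue s k (D : A -> A) q p v : compat s.+1 q ->
  compat k.+1 (D \o q) ->
  (forall f, is_derive p v (fun x => ev x f) (ev p (D f))) ->
  (realization (Delta_S R))^° p ->
  is_derive p v (glue q) (glue (D \o q) p).
Proof.
move=> C CD dev Dp.
apply: is_derive_quotient => //; apply/cvgrPdist_lt => e e0.
have near_q : \forall h \near (0 : R)^', forall i, (i < 8)%N ->
    `|ev p (D (q i)) - h^-1 *: (ev (h *: v + p) (q i) - ev p (q i))| < e.
  apply: (@near_ord8 _ (0 : R)^' _ (fun i h =>
    `|ev p (D (q i)) - h^-1 *: (ev (h *: v + p) (q i) - ev p (q i))| < e)) => i.
  have [/cvg_ex[d cd] dE] := dev (q i).
  have : (fun h : R => h^-1 *: (ev (h *: v + p) (q i) - ev p (q i))) @ 0^'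
      --> ev p (D (q i)).
    by rewrite -dE /derive (cvg_lim _ cd).
  by move/cvgrPdist_lt/(_ _ e0).
have cvp : (fun h : R => h *: v + p) @ (0 : R)^' --> p.
  apply: cvg_within_filter.
  have : (fun h : R => h *: v + p) @ (0 : R) --> (0 : R) *: v + p.
    by apply: cvgD; [apply: cvgZr_tmp; exact: cvg_id|exact: cvg_cst].
  by rewrite scale0r add0r.
have near_D : \forall h \near (0 : R)^', realization (Delta_S R) (h *: v + p).
  exact: cvp Dp.
have near_T : \forall h \near (0 : R)^', 
    forall i, (i < 8)%N -> in_tri i (h *: v + p) -> in_tri i p.
  exact: (cvp _ (near_in_tri p)).
apply: filterS3 near_q near_D near_T => h qh Dh Th.
have [i8 Ti] := tri_indexP Dh; have Tip := Th _ i8 Ti.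
by rewrite /= (glueE CD i8 Tip) (glueE C i8 Tip); apply: qh.
Qed.

End Geometry.

(** * Class C^r is equivalent to divisibility of the jumps *)

Section Smoothness.
Variable R : realType.
Notation A := {poly {poly R}}.
Implicit Types (f g l w : A) (p : R * R) (i j k n r s : nat) (q : nat -> A).

Section Derivation.
Variable D : A -> A.
Hypothesis DM : forall f g, D (f * g) = D f * g + f * D g.

Lemma derivation_pow_mul l n w : exists u, D (l ^+ n.+1 * w) = l ^+ n * u.
Proof.
elim: n => [|n [u IHn]]; first by exists (D (l * w)); rewrite mul1r.
exists (D l * w + u); rewrite exprS -mulrA DM IHn [l ^+ n.+1]exprS; ring.
Qed.

Lemma compat_derivation s q : (forall f g, D (f + g) = D f + D g) ->
  compat s.+2 q -> compat s.+1 (D \o q).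
Proof.
move=> DD C i j l e; have [w qw] := C _ _ _ e.
have [u Du] := derivation_pow_mul l s.+1 w; exists u => /=.
have -> : q i = q j + l ^+ s.+2 * w by rewrite -qw; ring.
by rewrite DD Du; ring.
Qed.

(** If f = l^(k+1) w', then D f = (k+1) c l^k w' + l^(k+1) D w'. As l^(k+1) divides D f and (k+1) c
    is invertible, l divides w', and the exponent rises by one. *)
Lemma pow_dvd_of_derivation l (c : R) n f u w : l != 0 -> c != 0 ->
  D l = c%:P%:P -> f = l * w -> D f = l ^+ n.+1 * u ->
  exists w', f = l ^+ n.+2 * w'.
Proof.
move=> nl nc Dl fw Df.
have DX k : D (l ^+ k.+1) = (c *+ k.+1)%:P%:P * l ^+ k.
  elim: k => [|k IHk]; first by rewrite Dl mulr1 mulr1n.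
  by rewrite exprS DM Dl IHk [l ^+ k.+1]exprS [c *+ k.+2]mulrS !polyCD; ring.
have step k : (k <= n)%N -> (exists w', f = l ^+ k.+1 * w') ->
    exists w', f = l ^+ k.+2 * w'.
  move=> kn [w' fw'].
  exists (((c *+ k.+1)^-1)%:P%:P * (l ^+ (n - k) * u - D w')).
  have nck : c *+ k.+1 != 0 by rewrite mulrn_eq0 negb_or.
  have E : (c *+ k.+1)%:P%:P * w' = l * (l ^+ (n - k) * u - D w').
    apply: (mulfI (expf_neq0 k nl)).
    have := Df; rewrite fw' DM DX -{1}(subnKC kn) -addSn exprD => E.
    rewrite [RHS](_ : _ = l ^+ k.+1 * l ^+ (n - k) * u - l ^+ k.+1 * D w').
      by rewrite -E; ring.
    by rewrite exprS; ring.
  rewrite fw' [in RHS]exprSr -mulrA; congr (_ * _).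
  by rewrite mulrCA -E mulrA -!polyCM mulVf // mul1r.
have all_k k : (k <= n.+1)%N -> exists w', f = l ^+ k.+1 * w'.
  elim: k => [|k IHk] kn; first by exists w; rewrite expr1.
  by apply: step => //; apply: IHk; apply: ltnW.
exact: all_k.
Qed.

End Derivation.

Lemma class_C_glue r q : compat r.+1 q ->
  class_C (realization (Delta_S R)) r (glue q).
Proof.
elim: r q => [|r IHr] q C; split; try exact: continuous_glue C; first by [].
have Cx : compat r.+1 (@pdx R \o q).
  by apply: compat_derivation => //; [exact: pdxM|exact: pdxD].
have Cy : compat r.+1 (@pdy R \o q).
  by apply: compat_derivation => //; [exact: pdyM|exact: pdyD].
exists (glue (@pdx R \o q)), (glue (@pdy R \o q)); split;
  [exact: IHr|exact: IHr|].
move=> p Dp; split.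
  by apply: (is_derive_glue C Cx _ Dp) => f; apply: is_derive_evx.
by apply: (is_derive_glue C Cy _ Dp) => f; apply: is_derive_evy.
Qed.

(** The witnesses are the centroids. *)
Lemma open_tri_center i : (i < 8)%N -> exists c, in_open_tri (R := R) i c.
Proof.
move: i; apply: lt8_ind.
- exists (1, 5 / 3); rewrite /in_open_tri /aff /=; apply/and3P; split; lra.
- exists (2, 4 / 3); rewrite /in_open_tri /aff /=; apply/and3P; split; lra.
- exists (3, 5 / 3); rewrite /in_open_tri /aff /=; apply/and3P; split; lra.
- exists (11 / 3, 1); rewrite /in_open_tri /aff /=; apply/and3P; split; lra.
- exists (3, 1 / 3); rewrite /in_open_tri /aff /=; apply/and3P; split; lra.
- exists (2, 2 / 3); rewrite /in_open_tri /aff /=; apply/and3P; split; lra.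
- exists (1, 1 / 3); rewrite /in_open_tri /aff /=; apply/and3P; split; lra.
- exists (1 / 3, 1); rewrite /in_open_tri /aff /=; apply/and3P; split; lra.
Qed.

Lemma open_tri_sub i p : in_open_tri i p -> in_tri i p.
Proof. by case/and3P=> h0 h1 h2; apply/and3P; split; apply: ltW. Qed.

Lemma open_tri_near i p : in_open_tri i p ->
  \forall p' \near p, in_open_tri i p'.
Proof.
have H u : 0 < aff u p -> \forall p' \near p, 0 < aff u p'.
  move=> up; have /cvgrPdist_lt/(_ _ up) := @continuous_aff R u p.
  by apply: filterS => p'; rewrite ltr_distlC => /andP[+ _]; rewrite subrr.
by case/and3P=> /H h0 /H h1 /H h2; apply: filterS3 h0 h1 h2 => *; apply/and3P;
  split.
Qed.

(** Continuity along the segment from p to an interior point: for 0 < t < 1 each barycentric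
    coordinate is a convex combination of a nonnegative and a positive number. *)
Lemma eq_on_closed_tri (F : R * R -> R) i f p : (i < 8)%N ->
  {within realization (Delta_S R), continuous F} ->
  (forall p', in_open_tri i p' -> F p' = ev p' f) -> in_tri i p ->
  F p = ev p f.
Proof.
move=> i8 /subspace_continuousP cF eqF Tp.
have [c Tc] := open_tri_center i8.
pose z (t : R) : R * R := t *: (c - p) + p.
have cz : z @ (0 : R)^'+ --> p.
  have : z @ (0 : R) --> (0 : R) *: (c - p) + p.
    by apply: cvgD; [apply: cvgZr_tmp; exact: cvg_id|exact: cvg_cst].
  by rewrite scale0r add0r => /cvg_at_right_filter.
have Tz : \forall t \near (0 : R)^'+, in_open_tri i (z t).
  near=> t.
  have t0 : 0 < t by near: t; exact: nbhs_right_gt.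
  have t1 : t < 1 by near: t; exact: nbhs_right_lt.
  have affz u : 0 <= aff u p -> 0 < aff u c -> 0 < aff u (z t).
    move=> up uc; rewrite (_ : aff u (z t) = (1 - t) * aff u p + t * aff u c).
      by apply: ltr_wpDl; [apply: mulr_ge0; lra|apply: mulr_gt0].
    by rewrite /aff /z /= /GRing.scale /=; ring.
  by case/and3P: Tp => p0 p1 p2; case/and3P: Tc => c0 c1 c2; apply/and3P;
    split; apply: affz.
have inD p' : in_tri i p' -> realization (Delta_S R) p'.
  by move=> T; apply/realizationP; exists i.
have cz' : z @ (0 : R)^'+ --> within (realization (Delta_S R)) (nbhs p).
  move=> P nP; have := cz _ nP; move: Tz; apply: filterS2 => t Tt; apply.
  by apply: inD; apply: open_tri_sub.
have c1 : (F \o z) t @[t --> (0 : R)^'+] --> F p.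
  apply: (@cvg_comp _ _ _ z F _ _ _ cz'); exact: cF (inD _ Tp).
have c2 : (F \o z) t @[t --> (0 : R)^'+] --> ev p f.
  have : ev (z t) f @[t --> (0 : R)^'+] --> ev p f.
    exact: (@cvg_comp _ _ _ z (fun y => ev y f) _ _ _ cz (@continuous_ev R f p)).
  apply: cvg_trans; apply: near_eq_cvg.
  by move: Tz; apply: filterS => t Tt /=; rewrite eqF.
exact: (cvg_unique _ c1 c2).
Unshelve. all: by end_near.
Qed.

Lemma poly_eq0_on_itv (P : {poly R}) (c : R) :
  (forall u, c <= u <= c + 1 -> P.[u] = 0) -> P = 0.
Proof.
move=> P0; apply/eqP; apply: contraT => nP.
pose rs := [seq c + n.+1%:R^-1 | n <- iota 0 (size P)].
have : (size rs < size P)%N.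
  apply: max_poly_roots nP _ _.
    apply/allP => _ /mapP[n _ ->]; apply/rootP/P0.
    by rewrite lerDl invr_ge0 ler0n lerD2l invf_le1 ?ler1n ?ltr0n.
  rewrite map_inj_uniq ?iota_uniq // => m n /addrI /invr_inj /eqP.
  by rewrite eqr_nat eqSS => /eqP.
by rewrite size_map size_iota ltnn.
Qed.

Definition point (u v : R) : R * R := ((u + v + 2) / 2, (u - v + 2) / 2).

Lemma ev_point (u v : R) f : ev (point u v) f = f.[v%:P].[u].
Proof.
have ea : coord_a (point u v) = u by rewrite /coord_a /=; field.
have eb : coord_b (point u v) = v by rewrite /coord_b /=; field.
by rewrite /ev ea eb.
Qed.

Lemma horner2 f (L : {poly R}) (u : R) : f.[L].[u] = f.[(L.[u])%:P].[u].
Proof.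
elim/poly2_closed_ind: f => [c|||f g|f g].
- by rewrite !hornerC.
- by rewrite !hornerC.
- by rewrite !hornerX hornerC.
- by rewrite !hornerD => -> ->.
- by rewrite !hornerM => -> ->.
Qed.

Lemma dvd_outer_line f (L : {poly R}) (c : R) :
  (forall u, c <= u <= c + 1 -> ev (point u L.[u]) f = 0) ->
  exists w, f = ('X - L%:P) * w.
Proof.
move=> f0; have : f.[L] = 0.
  by apply: (@poly_eq0_on_itv _ c) => u /f0; rewrite ev_point -horner2.
by move/eqP/factor_theorem => [w ->]; exists w; rewrite mulrC.
Qed.

Lemma horner_mid f (a v : R) : (map_poly (horner_eval a) f).[v] = f.[v%:P].[a].
Proof.
transitivity ((map_poly (horner_eval a) f).[horner_eval a v%:P]).
  by rewrite [horner_eval a v%:P]hornerC.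
exact: horner_map.
Qed.

(** The divisor is constant in the outer variable, so the factor theorem is applied to each
    coefficient. *)
Lemma dvd_inner_line f (a c : R) :
  (forall v, c <= v <= c + 1 -> ev (point a v) f = 0) ->
  exists w, f = ('X - a%:P)%:P * w.
Proof.
move=> f0; have g0 : map_poly (horner_eval a) f = 0.
  by apply: (@poly_eq0_on_itv _ c) => v /f0; rewrite ev_point -horner_mid.
exists (map_poly (fun P => P %/ ('X - a%:P)) f).
apply/polyP => i; rewrite coefCM coef_map_id0 ?div0p // mulrC divpK //.
rewrite dvdp_XsubCl; apply/rootP.
by have := congr1 (fun P : {poly R} => P`_i) g0; rewrite coef_map /= coef0.
Qed.

Lemma interior_edge_dvd q i j l : interior_edge i j l ->
  (forall p, in_tri i p -> in_tri j p -> ev p (q i - q j) = 0) ->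
  exists w, q i - q j = l * w.
Proof.
have XE : 'X = 'X - (0 : {poly R})%:P by rewrite subr0.
have YE : 'X%:P = ('X - (0 : R)%:P)%:P by rewrite subr0.
case.
all: rewrite /in_tri /aff /= => q0.
(* In each case the number supplied is the lower end of a unit parameter interval inside the common
   edge. *)
- rewrite XE; apply: (@dvd_outer_line _ _ 0) => u u01; apply: q0;
  rewrite /= hornerC; apply/and3P; split; lra.
- apply: (@dvd_outer_line _ _ 0) => u u01; apply: q0;
  rewrite /= hornerX; apply/and3P; split; lra.
- rewrite YE; apply: (@dvd_inner_line _ _ 0) => u u01; apply: q0;
  rewrite /=; apply/and3P; split; lra.
- rewrite XE; apply: (@dvd_outer_line _ _ (-1)) => u u01; apply: q0;
  rewrite /= hornerC; apply/and3P; split; lra.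
- rewrite YE; apply: (@dvd_inner_line _ _ (-1)) => u u01; apply: q0;
  rewrite /=; apply/and3P; split; lra.
- apply: (@dvd_inner_line _ _ 0) => u u01; apply: q0;
  rewrite /=; apply/and3P; split; lra.
- apply: (@dvd_outer_line _ _ 2) => u u01; apply: q0;
  rewrite /= hornerC; apply/and3P; split; lra.
- apply: (@dvd_inner_line _ _ 2) => u u01; apply: q0;
  rewrite /=; apply/and3P; split; lra.
- apply: (@dvd_outer_line _ _ 0) => u u01; apply: q0;
  rewrite /= hornerC; apply/and3P; split; lra.
Qed.

Lemma interior_edge_lt8 i j l : interior_edge (R := R) i j l ->
  (i < 8)%N /\ (j < 8)%N.
Proof. by case. Qed.

(** No interior edge is vertical, so the derivative in y is transversal to every edge and alone
    detects the order of vanishing. *)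
Lemma interior_edge_pdy i j l : interior_edge (R := R) i j l ->
  l != 0 /\ exists2 c : R, c != 0 & pdy l = c%:P%:P.
Proof.
have pdyB f (c : R) : pdy (f - c%:P%:P) = pdy f.
  by rewrite -[c%:P%:P]opprK opprK -!polyCN pdyD pdyC addr0.
have n1 : (-1 : R) != 0 by rewrite oppr_eq0 oner_eq0.
have pos : pdy 'X%:P = (1 : R)%:P%:P by rewrite pdyXi.
have neg : pdy 'X = (-1 : R)%:P%:P.
  by rewrite pdyX -[1]/((1 : R)%:P%:P) -!polyCN.
have [na _ _] := linear_form_la R; have [nb _ _] := linear_form_lb R.
have [nc _ _] := linear_form_lc R; have [ne _ _] := linear_form_le R.
have [nh _ _] := linear_form_hline R.
have dc : pdy ('X - 2%:P)%:P = (1 : R)%:P%:P.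
  rewrite (_ : ('X - 2%:P)%:P = 'X%:P - 2%:P%:P) ?pdyB //.
  exact: polyCB.
have de : pdy ('X - 2%:P%:P) = (-1 : R)%:P%:P by rewrite pdyB.
have dh : pdy (hline R) = (-2 : R)%:P%:P.
  have := pdyD (hline R) 'X%:P; rewrite /hline subrK pdyX pdyXi => E.
  rewrite -[LHS](addrK 1) -E (_ : (-2 : R) = -1 - 1); last by ring.
  by rewrite !polyCB !polyCN !polyC1.
have n2 : (-2 : R) != 0 by rewrite oppr_eq0 pnatr_eq0.
have mk (f : A) (c : R) : f != 0 -> c != 0 -> pdy f = c%:P%:P ->
    f != 0 /\ exists2 c : R, c != 0 & pdy f = c%:P%:P.
  by move=> nf n0 df; split=> //; exists c.
have n0 := oner_neq0 R.
case; [exact: mk nb n1 neg|exact: mk nh n2 dh|exact: mk na n0 pos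
  |exact: mk nb n1 neg|exact: mk na n0 pos|exact: mk nc n0 dc
  |exact: mk ne n1 de|exact: mk nc n0 dc|exact: mk ne n1 de].
Qed.

Lemma continuous_edge_dvd (F : R * R -> R) q i j l :
  {within realization (Delta_S R), continuous F} ->
  (forall i, (i < 8)%N -> forall p, in_open_tri i p -> F p = ev p (q i)) ->
  interior_edge i j l -> exists w, q i - q j = l * w.
Proof.
move=> cF Fq e; have [i8 j8] := interior_edge_lt8 e.
apply: (interior_edge_dvd e) => p Ti Tj.
rewrite evB -(eq_on_closed_tri i8 cF (Fq i i8) Ti).
by rewrite -(eq_on_closed_tri j8 cF (Fq j j8) Tj) subrr.
Qed.

(** Induction through F_y, whose pieces are the [pdy (q k)]: its jumps are divisible by l^r when F
    is of class C^r with r > 0, and continuity of F gives one factor l, so [pow_dvd_of_derivation]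
    raises the power. *)
Lemma class_C_compat r (F : R * R -> R) q :
  class_C (realization (Delta_S R)) r F ->
  (forall i, (i < 8)%N -> forall p, in_open_tri i p -> F p = ev p (q i)) ->
  compat r.+1 q.
Proof.
elim: r F q => [|r IHr] F q CF Fq i j l e.
  case: CF => cF _; exact: continuous_edge_dvd cF Fq e.
have [cF [Fx [Fy [_ CFy Fd]]]] := CF.
have [w qw] := continuous_edge_dvd cF Fq e.
have Cy : compat r.+1 (@pdy R \o q).
  apply: (IHr Fy) => // k k8 p Tp.
  have nT := open_tri_near Tp.
  have Dp : (realization (Delta_S R))^° p.
    apply: filterS nT => p' /open_tri_sub Tp'.
    by apply/realizationP; exists k.
  have [_ Fyp] := Fd p Dp.
  have eFp : \forall p' \near p, F p' = ev p' (q k).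
    by apply: filterS nT => p' Tp'; apply: Fq.
  have := near_eq_is_derive eFp Fyp => -[_ <-].
  by have [_ ->] := is_derive_evy p (q k).
have [u Cu] := Cy _ _ _ e.
have [nl [c nc Dl]] := interior_edge_pdy e.
apply: (@pow_dvd_of_derivation (@pdy R) (@pdyM R) l c r _ u w nl nc Dl qw).
rewrite -Cu /=; apply/eqP; rewrite -subr_eq; apply/eqP.
by rewrite opprK -pdyD subrK.
Qed.

End Smoothness.

(** * Transport of dimensions to function spaces, and products of subspaces *)

Section HasDim.
Variable R : realType.

Lemma has_dim_of_vspace (V : lmodType R) (W : vectType R) (U : {vspace W})
    (Phi : W -> V) (S : set V) : linear Phi ->
  (forall w, w \in U -> Phi w = 0 -> w = 0) ->
  (forall v, S v <-> exists2 w, w \in U & v = Phi w) ->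
  has_dim S (\dim U).
Proof.
move=> Phi_lin Phi_inj SP.
pose L := GRing.isLinear.Build R W V _ Phi Phi_lin.
pose F : {linear W -> V} := HB.pack Phi L.
have PhiE (c : 'I_(\dim U) -> R) :
    \sum_i c i *: Phi (vbasis U)`_i = Phi (\sum_i c i *: (vbasis U)`_i).
  transitivity (F (\sum_i c i *: (vbasis U)`_i)) => //.
  by rewrite linear_sum; apply: eq_bigr => i _; rewrite linearZ.
have memU (c : 'I_(\dim U) -> R) : \sum_i c i *: (vbasis U)`_i \in U.
  by apply: memv_suml => i _; apply: memvZ; apply: vbasis_mem; apply: mem_nth;
    rewrite size_tuple.
exists (fun i => Phi (vbasis U)`_i); split=> [c|v].
  rewrite PhiE => /(Phi_inj _ (memU c)) c0.
  by move/freeP: (basis_free (vbasisP U)); apply.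
rewrite SP; split=> [[w wU ->]|[c ->]].
  exists (fun i => coord (vbasis U) i w).
  by rewrite PhiE -coord_vbasis.
by exists (\sum_i c i *: (vbasis U)`_i); rewrite ?memU ?PhiE.
Qed.

(** The product is the direct sum of the images of the [U i] under the coordinate inclusions. *)
Lemma dim_ffun_pred (W : vectType R) k (U : 'I_k -> {vspace W})
    (P : {vspace {ffun 'I_k -> W}}) :
  (forall w, w \in P <-> forall i, w i \in U i) ->
  \dim P = (\sum_i \dim (U i))%N.
Proof.
move=> PP.
pose iota0 i (v : W) : {ffun 'I_k -> W} := [ffun j => if j == i then v else 0].
have iota_lin i : linear (iota0 i).
  move=> a u v; apply/ffunP => j; rewrite !ffunE.
  by case: eqP => // _; rewrite scaler0 addr0.
have /choice[F FE] : forall i, exists f : 'Hom(W, {ffun 'I_k ->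
  W}), f =1 iota0 i.
  by move=> i; apply: linear_hom.
have sumE (u : 'I_k -> W) j : (\sum_i F i (u i)) j = u j.
  rewrite sum_ffunE (bigD1 j) //= big1 ?addr0 => [|i ij].
    by rewrite FE ffunE eqxx.
  by rewrite FE ffunE eq_sym (negbTE ij).
have dirF : directv (\sum_i (F i @: U i)).
  apply/directv_sum_independent => us usU us0 i _.
  have /choice[u uE] : forall i, exists v, us i = F i v.
    by move=> j; have /memv_imgP[v _ ->] := usU j isT; exists v.
  have : (\sum_i F i (u i)) i = 0.
    by under eq_bigr do rewrite -uE; rewrite us0 ffunE.
  by rewrite sumE uE => ->; rewrite linear0.
have -> : P = (\sum_i (F i @: U i))%VS.
  apply/vspaceP => w; apply/idP/memv_sumP => [/PP wU|[us usU ->]].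
    exists (fun i => F i (w i)); first by move=> i _; rewrite memv_img.
    by apply/ffunP => j; rewrite sumE.
  apply/PP => j.
  have /choice[u uE] : forall i, exists v, v \in U i /\ us i = F i v.
    by move=> i; have /memv_imgP[v vU ->] := usU i isT; exists v.
  rewrite (eq_bigr (fun i => F i (u i))) => [|i _]; last by have [] := uE i.
  by rewrite sumE; have [] := uE j.
rewrite (directvP dirF) /=; apply: eq_bigr => i _; apply: limg_dim_eq.
apply/eqP; rewrite -subv0; apply/subvP => v /memv_capP[_];
  rewrite memv_ker FE memv0.
by move/eqP/ffunP/(_ i); rewrite !ffunE eqxx => ->.
Qed.

End HasDim.

(** * Uniqueness of the pieces, and passage between polynomials in x, y and in a, b *)

Section PolynomialRestrictions.
Variable R : realType.
Notation A := {poly {poly R}}.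
Notation mp := (mpoly 2 R).

Lemma ev_box_eq0 (f : A) (c c' : R) :
  (forall u v, c <= u <= c + 1 -> c' <= v <= c' + 1 -> ev (point u v) f = 0) ->
  f = 0.
Proof.
move=> f0; apply/polyP => i; rewrite coef0.
apply: (@poly_eq0_on_itv _ _ c) => u uc.
have g0 : map_poly (horner_eval u) f = 0.
  apply: (@poly_eq0_on_itv _ _ c') => v vc.
  by rewrite horner_mid -ev_point; apply: f0.
by have := congr1 (fun P : {poly R} => P`_i) g0; rewrite coef_map /= coef0.
Qed.

Lemma ev_tri_eq0 i (f : A) : (i < 8)%N ->
  (forall p, in_tri i p -> ev p f = 0) -> f = 0.
Proof.
move: i; apply: lt8_ind; rewrite /in_tri /aff /= => f0.
(* The two numbers are the lower corner, in the coordinates a and b, of a unit square inside the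
   triangle. *)
- apply: (@ev_box_eq0 _ 0 (-1)) => u v /andP[u0 u1] /andP[v0 v1];
    apply: f0; apply/and3P; rewrite /=; split; lra.
- apply: (@ev_box_eq0 _ 1 0) => u v /andP[u0 u1] /andP[v0 v1];
    apply: f0; apply/and3P; rewrite /=; split; lra.
- apply: (@ev_box_eq0 _ 2 1) => u v /andP[u0 u1] /andP[v0 v1];
    apply: f0; apply/and3P; rewrite /=; split; lra.
- apply: (@ev_box_eq0 _ 2 2) => u v /andP[u0 u1] /andP[v0 v1];
    apply: f0; apply/and3P; rewrite /=; split; lra.
- apply: (@ev_box_eq0 _ 1 2) => u v /andP[u0 u1] /andP[v0 v1];
    apply: f0; apply/and3P; rewrite /=; split; lra.
- apply: (@ev_box_eq0 _ 0 1) => u v /andP[u0 u1] /andP[v0 v1];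
    apply: f0; apply/and3P; rewrite /=; split; lra.
- apply: (@ev_box_eq0 _ (-1) 0) => u v /andP[u0 u1] /andP[v0 v1];
    apply: f0; apply/and3P; rewrite /=; split; lra.
- apply: (@ev_box_eq0 _ (-1) (-1)) => u v /andP[u0 u1] /andP[v0 v1];
    apply: f0; apply/and3P; rewrite /=; split; lra.
Qed.

Definition mp_lt n (q : mp) := (mmeasure mdeg q <= n)%N.

Lemma mp_lt_mono n k q : (n <= k)%N -> mp_lt n q -> mp_lt k q.
Proof. by move=> nk nq; apply: leq_trans nq nk. Qed.

Lemma mp_ltD n q q' : mp_lt n q -> mp_lt n q' -> mp_lt n (q + q').
Proof.
by move=> nq nq'; apply: leq_trans (mmeasureD_le _ _ _) _; rewrite geq_max;
  apply/andP.
Qed.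

Lemma mp_ltN n q : mp_lt n q -> mp_lt n (- q).
Proof. by rewrite /mp_lt mmeasureN. Qed.

Lemma mp_ltM n k q q' : mp_lt n.+1 q -> mp_lt k q' -> mp_lt (n + k) (q * q').
Proof.
have [->|nq] := eqVneq q 0; first by rewrite mul0r /mp_lt mmeasure0.
have [->|nq'] := eqVneq q' 0; first by rewrite mulr0 /mp_lt mmeasure0.
rewrite /mp_lt msizeM // => h h'.
by move: (leq_add h h'); case: (_ + _)%N.
Qed.

Lemma mp_ltC (c : R) : mp_lt 1 (mpolyC 2 c).
Proof. by rewrite /mp_lt mmeasureC; case: (_ != _). Qed.

Lemma mp_lt_exp n q : mp_lt 2 q -> mp_lt n.+1 (q ^+ n).
Proof.
move=> dq; elim: n => [|n IHn]; first exact: (mp_ltC 1).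
by rewrite exprS; apply: (mp_ltM dq IHn).
Qed.

Lemma mp_lt_sum n (I : Type) (r : seq I) (P : pred I) (F : I -> mp) :
  (forall i, P i -> mp_lt n (F i)) -> mp_lt n (\sum_(i <- r | P i) F i).
Proof.
move=> dF; elim/big_ind: _ => //; first by rewrite /mp_lt mmeasure0.
exact: mp_ltD.
Qed.

Definition mvar (i : 'I_2) : mp := mpolyX R (mnm1 i).

Lemma mp_lt_var i : mp_lt 2 (mvar i).
Proof. by rewrite /mp_lt mmeasureX /= mdeg1. Qed.

Definition coords (p : R * R) (i : 'I_2) := if i == ord0 then p.1 else p.2.

Definition mp_a : mp := mvar ord0 + mvar ord_max - mpolyC 2 2.
Definition mp_b : mp := mvar ord0 - mvar ord_max.

Lemma mp_lt_ab : mp_lt 2 mp_a /\ mp_lt 2 mp_b.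
Proof.
split; apply: mp_ltD; try exact: mp_lt_var.
- by apply: mp_ltD; apply: mp_lt_var.
- by apply: mp_ltN; apply: mp_lt_mono (mp_ltC _).
- by apply: mp_ltN; apply: mp_lt_var.
Qed.

Lemma meval_ab p : meval (coords p) mp_a =
  coord_a p /\ meval (coords p) mp_b = coord_b p.
Proof. by rewrite /mp_a /mp_b !mevalB mevalD mevalC !mevalXU. Qed.

Definition mp_of (f : A) : mp := \sum_(i < size f) \sum_(j < size f`_i)
  mpolyC 2 f`_i`_j * (mp_a ^+ j * mp_b ^+ i).

Lemma mp_lt_of n f : deg_lt n f -> mp_lt n (mp_of f).
Proof.
move=> df; have [da db] := mp_lt_ab.
apply: mp_lt_sum => i _; apply: mp_lt_sum => j _.
have [->|nf] := eqVneq (f`_i`_j) 0;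
  first by rewrite mpolyC0 mul0r /mp_lt mmeasure0.
apply: (mp_ltM (mp_ltC _)).
apply: (@mp_lt_mono (j + i.+1)); last by apply: mp_ltM; apply: mp_lt_exp.
by rewrite addnS leqNgt; apply: contra nf => ij; rewrite df // addnC.
Qed.

Lemma meval_mp_of f p : meval (coords p) (mp_of f) = ev p f.
Proof.
have [ea eb] := meval_ab p.
have evsum (I : Type) (r : seq I) (F : I -> A) :
    ev p (\sum_(i <- r) F i) = \sum_(i <- r) ev p (F i).
  by apply: (big_morph (ev p)); [exact: evD|exact: (evC p 0)].
rewrite [in RHS](polyXiE f) evsum rmorph_sum /=; apply: eq_bigr => i _.
rewrite evsum rmorph_sum /=; apply: eq_bigr => j _.
by rewrite !mevalM !evM evC mevalC !rmorphXn /= ea eb !evXn evXi evX.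
Qed.

Definition poly_x : A := (2^-1)%:P%:P * ('X%:P + 'X) + 1.
Definition poly_y : A := (2^-1)%:P%:P * ('X%:P - 'X) + 1.

Lemma deg_lt_xy : deg_lt 2 poly_x /\ deg_lt 2 poly_y.
Proof.
have d1 : deg_lt 2 (1 : A) by apply: deg_lt_mono (@deg_lt1 R).
split; apply: deg_ltD => //; apply: deg_ltCM.
  by apply: deg_ltD; [apply: deg_ltXi|apply: deg_ltX].
by apply: deg_ltB; [apply: deg_ltXi|apply: deg_ltX].
Qed.

Lemma ev_xy p : ev p poly_x = p.1 /\ ev p poly_y = p.2.
Proof.
rewrite /poly_x /poly_y !(evD, evM, evN) !evC evXi evX.
by rewrite /coord_a /coord_b; split; field.
Qed.

Definition of_mp (q : mp) : A := \sum_(m <- msupp q)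
  (mcoeff m q)%:P%:P * (poly_x ^+ m ord0 * poly_y ^+ m ord_max).

Lemma deg_lt_of_mp n q : mp_lt n q -> deg_lt n (of_mp q).
Proof.
move=> dq; have [dx dy] := deg_lt_xy.
rewrite /of_mp big_seq; apply: deg_lt_sum => m mq.
have dm : (mdeg m < mmeasure mdeg q)%N by apply: mmeasure_mnm_lt.
apply: deg_ltCM; apply: (@deg_lt_mono _ (m ord0 + (m ord_max).+1)); last first.
  by apply: deg_ltM; apply: deg_lt_exp.
apply: leq_trans dq; apply: leq_trans dm.
rewrite mdegE big_ord_recl big_ord_recl big_ord0 addn0 addnS.
by rewrite (_ : lift _ _ = ord_max) //; apply/val_inj.
Qed.

Lemma ev_of_mp q p : ev p (of_mp q) = meval (coords p) q.
Proof.
have [ex ey] := ev_xy p.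
rewrite mevalE /of_mp (big_morph (ev p) (id1 := 0) (op1 := +%R)); first last.
- exact: (evC p 0).
- exact: evD.
apply: eq_bigr => m _; rewrite !evM evC !evXn ex ey.
rewrite big_ord_recl big_ord_recl big_ord0 mulr1 (_ : lift _ _ = ord_max) //.
exact/val_inj.
Qed.

Lemma poly_onP d (B : set (R * R)) (F : R * R -> R) :
  poly_on d B F <-> exists2 f : A, deg_lt d.+1 f & forall p, B p -> F p =
    ev p f.
Proof.
split=> [[q dq Fq]|[f df Ff]].
  exists (of_mp q); first exact: deg_lt_of_mp.
  by move=> p /Fq->; rewrite ev_of_mp.
exists (mp_of f); first exact: mp_lt_of.
by move=> p /Ff->; rewrite -meval_mp_of.
Qed.

End PolynomialRestrictions.

(** * Splines as glued compatible families, and the linear parametrization *)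

Section SplineDimension.
Variable R : realType.
Notation A := {poly {poly R}}.
Implicit Types (q w : nat -> A) (i s n r d : nat).

Lemma splineP r d (f : set_type (realization (Delta_S R)) -> R^o) :
  spline (Delta_S R) r d f <->
  exists q, [/\ forall i, (i < 8)%N -> deg_lt d.+1 (q i), compat r.+1 q
              & f = (fun p => glue q (set_val p))].
Proof.
split=> [[F [fF CF Fpoly]]|[q [dq Cq ->]]]; last first.
  exists (glue q); split=> //; first exact: class_C_glue.
  move=> T /(nthP (tri R 8)) [i i8 <-]; apply/poly_onP; exists (q i);
    first exact: dq.
  by move=> p /(tri_setP _ i8) Tp; apply: glueE Cq i8 Tp.
have /choice[q qP] : forall i, exists g : A, (i < 8)%N ->
    deg_lt d.+1 g /\ forall p, in_tri i p -> F p = ev p g.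
  move=> i; case: (ltnP i 8) => i8; last by exists 0.
  have /poly_onP[g dg Fg] : poly_on d (tri_set (tri R i)) F.
    by apply: Fpoly; apply: mem_nth.
  by exists g => _; split=> // p Tp; apply: Fg; apply/tri_setP.
exists q; split.
- by move=> i /qP[].
- apply: (class_C_compat CF) => i i8 p /open_tri_sub.
  by have [_] := qP i i8; apply.
- apply/funext => p; have [i8 Ti] := tri_indexP (set_valP p).
  by rewrite fF /glue; have [_] := qP _ i8; apply.
Qed.

Lemma glue_eq0 r q : compat r.+1 q ->
  (forall p : set_type (realization (Delta_S R)), glue q (set_val p) = 0) ->
  forall i, (i < 8)%N -> q i = 0.
Proof.
move=> C q0 i i8; apply: (ev_tri_eq0 i8) => p Tp.
have Dp : realization (Delta_S R) p by apply/realizationP; exists i.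
by rewrite -(glueE C i8 Tp); apply: (q0 (SigSub (mem_set Dp))).
Qed.

Lemma spline_of_ext s w w' i : (forall k, (k < 8)%N -> w k = w' k) ->
  spline_of s w i = spline_of s w' i.
Proof.
by move=> e; case: i => [|[|[|[|[|[|[|[|i]]]]]]]] //=; rewrite !e.
Qed.

Lemma spline_of_linear s (c : R) w w' i :
  spline_of s (fun k => c%:P%:P * w k + w' k) i =
  c%:P%:P * spline_of s w i + spline_of s w' i.
Proof.
have qA f g : quoA s (c%:P%:P * f + g) = c%:P%:P * quoA s f + quoA s g.
  apply/polyP => u; apply/polyP => v.
  rewrite !(coefD, coefCM) !coef_map_id0 ?drop_poly0r //.
  by rewrite !(coef_drop_poly, coefD, coefCM).
have qB f g : quoB s (c%:P%:P * f + g) = c%:P%:P * quoB s f + quoB s g.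
  apply/polyP => u; apply/polyP => v.
  rewrite !(coefD, coefCM) !coef_drop_poly !coef_map_id0 ?take_poly0r //.
  rewrite !coef_take_poly !(coefD, coefCM).
  by case: ifP => //; rewrite mulr0 addr0.
have qE f g : quoE s (c%:P%:P * f + g) = c%:P%:P * quoE s f + quoE s g.
  by rewrite /quoE tau_linear qB tau_linear.
have hl f g : hline R ^+ s * (c%:P%:P * f + g) =
    c%:P%:P * (hline R ^+ s * f) + hline R ^+ s * g by ring.
rewrite /spline_of hl qA qE.
(* Cofactors and powers become variables, so that [ring] faces an identity without exponents. *)
move: (quoA s _) (quoA s _) (quoE s _) (quoE s _) => a a' b b'.
move: (c%:P%:P) => C; move: (hline R ^+ s * w 7%N) => g.
move: (hline R ^+ s * w' 7%N) => g'.
move: ('X%:P ^+ s : A) => la; move: (('X - 2%:P)%:P ^+ s : A) => lc.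
move: ('X ^+ s : A) => lb; move: (('X - 2%:P%:P) ^+ s : A) => le.
case: i => [|[|[|[|[|[|[|[|i]]]]]]]]; first ring; last by rewrite mulr0 addr0.
all: ring.
Qed.

Lemma subspace_parameter s n i : subspace (parameter (R := R) s n i).
Proof.
case: i => [|[|[|[|[|[|[|i]]]]]]] /=; try exact: subspace_deg_lt.
exact: subspace_colon.
Qed.

Lemma deg_lt_parameter s n i (f : A) : parameter s n i f -> deg_lt n f.
Proof.
case: i => [|[|[|[|[|[|[|i]]]]]]] //=; try (apply: deg_lt_mono; lia).
by case=> + _ _; apply: deg_lt_mono; lia.
Qed.

(** [Phi] glues the family built from eight parameters. It is injective by [spline_of_eq0] and
    reaches all splines by [compat_spline_ofP], so the dimensions of the parameter spaces add up. *)
Lemma has_dim_spline r d (n := d.+1) (s := r.+1)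
    (U : 'I_8 -> {vspace 'M[R]_n}) : (2 * s <= n)%N ->
  (forall (i : 'I_8) M, M \in U i <-> parameter s n i (of_mx M)) ->
  has_dim (spline (Delta_S R) r d) (\sum_i \dim (U i)).
Proof.
move=> sn UP.
pose vals (w : {ffun 'I_8 -> 'M[R]_n}) (k : nat) : A := of_mx (w (inord k)).
pose Phi (w : {ffun 'I_8 -> 'M[R]_n}) :
    set_type (realization (Delta_S R)) -> R^o :=
  fun p => glue (spline_of s (vals w)) (set_val p).
have [P PP] : exists P : {vspace {ffun 'I_8 -> 'M[R]_n}},
    forall w : {ffun 'I_8 -> 'M[R]_n}, w \in P <-> forall i : 'I_8, w i \in U i.
  apply: vspace_of_pred => [i|a u v Pu Pv i]; rewrite !ffunE ?mem0v //.
  by rewrite memvD ?memvZ.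
have parP (w : {ffun 'I_8 -> 'M[R]_n}) : w \in P -> forall k, (k < 8)%N ->
  parameter s n k (vals w k).
  move=> /PP wU k k8; have /UP := wU (inord k).
  by rewrite inordK.
rewrite -(dim_ffun_pred PP); apply: (has_dim_of_vspace (Phi := Phi)).
- move=> c w w'; apply/funext => p; rewrite /Phi /glue.
  rewrite (spline_of_ext s (w' := fun k => c%:P%:P * vals w k + vals w' k)).
    by rewrite spline_of_linear evD evM evC.
  by move=> k _; rewrite /vals !ffunE of_mx_linear.
- move=> w wP w0.
  have C := compat_spline_of (parP _ wP).
  have q0 := glue_eq0 C (fun p => congr1 (fun f => f p) w0).
  have v0 := spline_of_eq0 q0.
  apply/ffunP => i; rewrite !ffunE -(of_mxK (w i)).
  have := v0 i (ltn_ord i); rewrite /vals inord_val => ->.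
  by rewrite -(of_mx0 R n) of_mxK.
- move=> f; rewrite splineP; split=> [[q [dq Cq ->]]|[w wP ->]].
    have [v [vP qv]] := compat_spline_ofP sn dq Cq.
    pose w := [ffun i : 'I_8 => to_mx n (v i)].
    have valsw k : (k < 8)%N -> vals w k = v k.
      move=> k8; rewrite /vals ffunE inordK // to_mxK //.
      exact: deg_lt_parameter (vP k k8).
    exists w.
      by apply/PP => i; apply/UP; have := vP i (ltn_ord i);
        rewrite -(valsw i (ltn_ord i)) /vals inord_val.
    apply/funext => p; have [i8 _] := tri_indexP (set_valP p).
    by rewrite /Phi /glue (qv _ i8) (spline_of_ext s _ valsw).
  exists (spline_of s (vals w)); split=> //.
    by move=> i _; apply: deg_lt_spline_of => //; apply: parP.
  exact: compat_spline_of (parP _ wP).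
Qed.

End SplineDimension.

(** * Closed form of sigma and the final count *)

Lemma sum_truncated r :
  (4 * (\sum_(j < r) (r.+1 - 2 * j.+1)) + odd r = r * r)%N.
Proof.
elim/ltn_ind: r => -[|[|r]] IHr; first by rewrite big_ord0.
  by rewrite big_ord_recl big_ord0.
have {IHr} := IHr r (leqnSn _); rewrite /= negbK.
rewrite big_ord_recl [in X in _ -> X]big_ord_recr /=.
have -> : (\sum_(i < r) (r.+3 - 2 * (bump 0 i).+1) =
  \sum_(i < r) (r.+1 - 2 * i.+1))%N.
  by apply: eq_bigr => k _; rewrite /bump /=; lia.
by rewrite /bump /=; lia.
Qed.

Lemma sigmaE r : sigma r = (2 * \sum_(j < r) (r.+1 - 2 * j.+1))%N%:Z.
Proof.
rewrite /sigma PoszM; congr (_ * _); rewrite big_add1 /= big_mkord.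
rewrite (big_morph Posz PoszD (erefl _)); apply: eq_bigr => j _; lia.
Qed.

Theorem mainTheorem1 (R : realType) (r d : nat) (hd : (2 * r + 1 <= d)%N) :
  exists2 n : nat, has_dim (spline (Delta_S R) r d) n & n%:Z%R = L r d.
Proof.
have sn : (2 * r.+1 <= d.+1)%N by lia.
have /choice[U UP] : forall i : 'I_8, exists U : {vspace 'M[R]_d.+1},
    forall M, M \in U <-> parameter r.+1 d.+1 i (of_mx M).
  by move=> i; apply: subspace_vspace; apply: subspace_parameter.
exists (\sum_i \dim (U i))%N; first exact: has_dim_spline.
(* With s = r + 1, e = d + 1 - 2 s is the strict degree bound of the syzygy parameters; d >= 2 r + 1
   makes the subtraction exact. *)
pose e := (d.+1 - r.+1 - r.+1)%N.
have dN : (d.+1 - r.+1 = e + r.+1)%N by rewrite /e; lia.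
pose dims := [:: 'C(d.+2, 2); 'C((e + r.+1).+1, 2); 'C((e + r.+1).+1, 2);
  'C((e + r.+1).+1, 2); 'C((e + r.+1).+1, 2); 'C(e.+1, 2); 'C(e.+1, 2);
  ('C(e.+1, 2) + r.+1 * e + uphalf r.+1)%N].
have dimU (i : 'I_8) : \dim (U i) = nth 0%N dims i.
  have le1 : (e + r.+1 <= d.+1)%N by rewrite /e; lia.
  have le2 : (e <= d.+1)%N by apply: leq_trans (leq_addr _ _) le1.
  case: i => -[|[|[|[|[|[|[|[|i]]]]]]]] i8 //;
    try by [apply: (dim_deg_lt le2) => M; apply: UP
           |apply: (dim_deg_lt le1) => M; rewrite -dN; apply: UP].
    by apply: (dim_deg_lt (leqnn _)) => M; apply: UP.
  by apply: (dim_colon le1) => M; rewrite -dN; apply: UP.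
rewrite (eq_bigr _ (fun i _ => dimU i)) !big_ord_recl big_ord0 /= addn0.
(* Writing d through e and r removes all truncated subtractions; with the binomials doubled, a
   polynomial identity remains for each parity of r. *)
have dE : d = (e + 2 * r + 1)%N by rewrite /e; lia.
rewrite /L sigmaE (_ : (d - r).+1 = (e + r.+1).+1); last by lia.
have := sum_truncated r; have := bin2S d.+1; have := bin2S (e + r.+1).
have := bin2S e; have := bin2S r.+1.
have := odd_double_half r.
by clear dimU UP U sn dN hd dims; move: dE; move: (e) => e' ->;
  case: (odd r) => /=; nia.
Qed.
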